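(* For every constant $\epsilon>0$ there is a polynomial-time $(\frac65+\epsilon)$-approximation algorithm for the Pure Fixed Charge Transportation problem with Uniform Fixed Costs (PFCT-U): given any PFCT-U instance, it outputs a feasible solution whose cost is at most $(\frac65+\epsilon)$ times the optimum cost.
   Context: An instance of PFCT-U consists of a set $S$ of $n$ sources and a set $T$ of $m$ sinks; each source $i$ has supply $a_i\in\mathbb{Z}_{>0}$, each sink $j$ has demand $b_j\in\mathbb{Z}_{>0}$, with $\sum_{i\in S}a_i=\sum_{j\in T}b_j$. The feasible set is $\mathcal{X}=\{x\in\mathbb{R}_{\ge0}^{S\times T}:\sum_{j\in T}x_{ij}=a_i\ \forall i\in S,\ \sum_{i\in S}x_{ij}=b_j\ \forall j\in T\}$, and the cost of $x\in\mathcal{X}$ is $|\{(i,j)\in S\times T: x_{ij}>0\}|$ (i.e., all fixed costs equal $1$ and there are no linear costs); the goal is to minimize the cost. *)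

(* Defs.v *)
From Stdlib Require Import BinNums.
From mathcomp Require Import all_boot all_order all_algebra.
From mathcomp Require Import reals.

Set Implicit Arguments.
Unset Strict Implicit.
Unset Printing Implicit Defensive.

Import Order.TTheory GRing.Theory Num.Theory.

(* Model of computation: imperative programs over binary trees, i.e. Jones'
   WHILE language.  An assignment costs one plus the size of the stored tree,
   not just one: otherwise iterating [X := Node X X] would build trees of
   exponential size in linear time.  A test inspects only the root of a
   variable and costs one.  With these charges programs and Turing machines
   simulate each other with polynomial overhead. *)

Inductive tree : Type := Leaf | Node of tree & tree.

Fixpoint tree_size (t : tree) : nat :=
  if t is Node l r then (tree_size l + tree_size r).+1 else 1.

Definition is_leaf (t : tree) : bool := if t is Leaf then true else false.

Inductive expr : Type :=
  | EVar of nat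
  | ELeaf
  | ENode of expr & expr
  | ELeft of expr
  | ERight of expr.

Inductive cmd : Type :=
  | Skip
  | Assign of nat & expr
  | Seq of cmd & cmd
  | If of nat & cmd & cmd
  | While of nat & cmd.

Definition store : Type := nat -> tree.

Definition update (s : store) (x : nat) (v : tree) : store :=
  fun y => if y == x then v else s y.

Fixpoint eval (s : store) (e : expr) : tree :=
  match e with
  | EVar x => s x
  | ELeaf => Leaf
  | ENode e1 e2 => Node (eval s e1) (eval s e2)
  | ELeft e1 => if eval s e1 is Node l _ then l else Leaf
  | ERight e1 => if eval s e1 is Node _ r then r else Leaf
  end.

(* [exec c s k s']: started in [s], [c] halts in [s'] after a running time
   of exactly [k].  A variable tests as true when it is not [Leaf]. *)
Inductive exec : cmd -> store -> nat -> store -> Prop :=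
  | exec_skip s : exec Skip s 1 s
  | exec_assign s x e :
      exec (Assign x e) s (tree_size (eval s e)).+1 (update s x (eval s e))
  | exec_seq c1 c2 s1 k1 s2 k2 s3 :
      exec c1 s1 k1 s2 -> exec c2 s2 k2 s3 ->
      exec (Seq c1 c2) s1 (k1 + k2) s3
  | exec_if_true x c1 c2 s k s' :
      ~~ is_leaf (s x) -> exec c1 s k s' -> exec (If x c1 c2) s k.+1 s'
  | exec_if_false x c1 c2 s k s' :
      is_leaf (s x) -> exec c2 s k s' -> exec (If x c1 c2) s k.+1 s'
  | exec_while_stop x c s :
      is_leaf (s x) -> exec (While x c) s 1 s
  | exec_while_step x c s1 k1 s2 k2 s3 :
      ~~ is_leaf (s1 x) -> exec c s1 k1 s2 -> exec (While x c) s2 k2 s3 ->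
      exec (While x c) s1 (k1 + k2).+1 s3.

Definition init_store (input : tree) : store := update (fun=> Leaf) 0 input.

(* Variable 0 holds both the input and the output. *)
Definition computes (c : cmd) (input : tree) (k : nat) (output : tree) : Prop :=
  exists2 s, exec c (init_store input) k s & s 0 = output.

(* [c] halts on every encoded instance, in time polynomial in the size of the
   encoding. *)
Definition poly_time (inst : Type) (enc : inst -> tree) (c : cmd) : Prop :=
  exists p : {poly nat}, forall I : inst, exists k output,
    computes c (enc I) k output /\ k <= p.[tree_size (enc I)]%R.

(* Numbers are encoded in binary, least significant bit first. *)

Definition enc_bool (b : bool) : tree := if b then Node Leaf Leaf else Leaf.

Fixpoint enc_list (s : seq tree) : tree :=
  if s is t :: s' then Node t (enc_list s') else Leaf.

Fixpoint pos_bits (p : positive) : seq bool :=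
  match p with
  | xH => [:: true]
  | xO q => false :: pos_bits q
  | xI q => true :: pos_bits q
  end.

Definition nat_bits (n : nat) : seq bool :=
  if bin_of_nat n is Npos p then pos_bits p else [::].

Definition enc_nat (n : nat) : tree :=
  enc_list [seq enc_bool b | b <- nat_bits n].

Local Open Scope ring_scope.

Definition enc_int (z : int) : tree := Node (enc_bool (z < 0)) (enc_nat `|z|%N).

Definition enc_rat (q : rat) : tree := Node (enc_int (numq q)) (enc_int (denq q)).

Record pfctu : Type := PFCTU {
  nsrc : nat;
  nsnk : nat;
  supply : 'I_nsrc -> nat;
  demand : 'I_nsnk -> nat;
  supply_gt0 : forall i, (0 < supply i)%N;
  demand_gt0 : forall j, (0 < demand j)%N;
  balanced : (\sum_i supply i = \sum_j demand j)%N
}.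

Definition enc_pfctu (I : pfctu) : tree :=
  Node (enc_list [seq enc_nat (supply i) | i <- enum 'I_(nsrc I)])
       (enc_list [seq enc_nat (demand j) | j <- enum 'I_(nsnk I)]).

Definition enc_plan (n m : nat) (x : 'M[rat]_(n, m)) : tree :=
  enc_list [seq enc_list [seq enc_rat (x i j) | j <- enum 'I_m] | i <- enum 'I_n].

Definition feasible (R : realType) (I : pfctu)
    (x : 'M[R]_(nsrc I, nsnk I)) : Prop :=
  [/\ forall i j, 0 <= x i j,
      forall i, \sum_j x i j = (supply i)%:R
    & forall j, \sum_i x i j = (demand j)%:R].

Definition cost (R : realType) (n m : nat) (x : 'M[R]_(n, m)) : nat :=
  #|[set ij : 'I_n * 'I_m | 0 < x ij.1 ij.2]|.

Definition is_optimum (R : realType) (I : pfctu) (v : nat) : Prop :=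
  (exists2 x : 'M[R]_(nsrc I, nsnk I), feasible x & cost x = v) /\
  (forall x : 'M[R]_(nsrc I, nsnk I), feasible x -> (v <= cost x)%N).

(* A program prints finite data, so the plan it outputs is rational; it is
   compared with the optimum over all real plans. *)
Definition approximates (R : realType) (rho : R) (c : cmd) : Prop :=
  forall I : pfctu, exists k (x : 'M[rat]_(nsrc I, nsnk I)),
    computes c (enc_pfctu I) k (enc_plan x) /\
    let y : 'M[R]_(nsrc I, nsnk I) := map_mx ratr x in
    feasible y /\ exists2 v, is_optimum R I v & (cost y)%:R <= rho * v%:R.

(* Main.v *)
Require Import Defs.
From mathcomp Require Import all_boot all_order all_algebra.
From mathcomp Require Import reals boolp.
From mathcomp Require Import zify ring lra.

(* A feasible plan whose support graph has k connected components uses at least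
   n + m - k cells, and each component is a balanced set of nodes ("block").
   Conversely, given p disjoint balanced blocks, filling greedily the cells of each
   block and then all the cells uses at most n + m - p positive cells, since every
   positive step exhausts a node and the last step inside a block exhausts two.
   For the ratio 6/5 a block B of an optimal partition is worth 6 - |B|, so only
   blocks with at most five nodes matter.

   The algorithm is a local search over families of disjoint balanced blocks with
   at most five nodes, which maximizes the sum of 7 - |A| by inserting a bounded
   number of blocks and removing those that they meet.  Local optimality on
   trees of the intersection graph is exploited by bounded-depth message passing,
   and a discharging argument then gives, for message depth K,
   sum (6 - |B|) <= 5 (1 + 1/K) p over the small blocks B of any partition.

   For the running time, the functions computed by polynomial-time programs on
   encoded data are closed under composition, pairing, case analysis, and folds
   whose accumulators stay polynomially bounded. *)

Set Implicit Arguments.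
Unset Strict Implicit.
Unset Printing Implicit Defensive.

Import Order.TTheory GRing.Theory Num.Theory.

(** * Polynomial-time programs *)

(** The worth 6 - |B| comes from the ratio. Let N be the number of nodes, q the number of blocks cut
    out by an optimal support and p the number of blocks found. The optimum is at least N - q, the
    greedy cost at most N - p, and 5(N - p) <= 6(N - q) says 6q - N <= 5p. Since N is the sum of the
    sizes of the q blocks, 6q - N is the sum of 6 - |B|, where blocks with more than five nodes
    contribute nothing positive. Every block has at least two nodes, so p <= N/2 <= N - q, and an
    error of 5p/K costs at most 5/K times the optimum. Two obstacles shape the analysis of local
    optima. The intersection graph may contain cycles, so the tree explored by the messages is a
    multiset of blocks rather than an exchange; its level sets are exchanges, and one of them
    improves if the multiset does. Moreover a bounded depth cannot settle what happens at the leaves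
    of the tree, so the estimate relates two consecutive depths, and the average over K depths
    leaves only a boundary term of relative size 1/K. *)

Definition pev (p : {poly nat}) (n : nat) : nat := (p.[n])%R.

Lemma pevD p q n : pev (p + q)%R n = pev p n + pev q n.
Proof. by rewrite /pev hornerD. Qed.

Lemma pevM p q n : pev (p * q)%R n = pev p n * pev q n.
Proof. by rewrite /pev hornerM. Qed.

Lemma pevX n : pev 'X%R n = n.
Proof. by rewrite /pev hornerX. Qed.

Definition pconst (c : nat) : {poly nat} := (c%:P)%R.

Lemma pevC c n : pev (pconst c) n = c.
Proof. by rewrite /pev hornerC. Qed.

Lemma pev_comp p q n : pev (p \Po q)%R n = pev p (pev q n).
Proof. by rewrite /pev horner_comp. Qed.

Definition pevE := (pevD, pevM, pevX, pevC, pev_comp).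

Lemma pev_mono p m n : m <= n -> pev p m <= pev p n.
Proof.
move=> lemn; elim/poly_ind: p => [|p c IHp]; first by rewrite /pev !horner0.
by rewrite /pev !hornerMXaddC leq_add2r leq_mul.
Qed.

(** Stores with finitely many variables set. Trailing leaves are invisible, so clearing the last
    scratch variable gives back literally the shorter store. *)
Definition st (l : seq tree) : store := fun y => nth Leaf l y.

Lemma update_st l x v : update (st l) x v = st (set_nth Leaf l x v).
Proof. by apply: funext => y; rewrite /update /st nth_set_nth. Qed.

Lemma st_rcons_leaf l : st (rcons l Leaf) = st l.
Proof.
apply: funext => y; rewrite /st nth_rcons.
by case: ltngtP => // le_ly; rewrite nth_default ?le_ly // ltnW.
Qed.

Fixpoint shift_expr d (e : expr) : expr :=
  match e with
  | EVar x => EVar (d + x)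
  | ELeaf => ELeaf
  | ENode e1 e2 => ENode (shift_expr d e1) (shift_expr d e2)
  | ELeft e1 => ELeft (shift_expr d e1)
  | ERight e1 => ERight (shift_expr d e1)
  end.

Fixpoint shift_cmd d (c : cmd) : cmd :=
  match c with
  | Skip => Skip
  | Assign x e => Assign (d + x) (shift_expr d e)
  | Seq c1 c2 => Seq (shift_cmd d c1) (shift_cmd d c2)
  | If x c1 c2 => If (d + x) (shift_cmd d c1) (shift_cmd d c2)
  | While x c1 => While (d + x) (shift_cmd d c1)
  end.

(** Frame of a subroutine call: the caller's first [d] variables stay untouched below the store [s]
    on which the shifted program works. *)
Definition above (d : nat) (S s : store) : store :=
  fun y => if y < d then S y else s (y - d).

Lemma above_shift d S s x : above d S s (d + x) = s x.
Proof. by rewrite /above ltnNge leq_addr addKn. Qed.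

Lemma eval_shift d S s e : eval (above d S s) (shift_expr d e) = eval s e.
Proof.
by elim: e => //= [x|e1 -> e2 ->|e1 ->|e1 ->] //; rewrite above_shift.
Qed.

Lemma update_shift d S s x v :
  update (above d S s) (d + x) v = above d S (update s x v).
Proof.
apply: funext => y; rewrite /update /above; case: ltnP => le_dy.
  by rewrite ltn_eqF // ltn_addr.
by rewrite -{1}(subnKC le_dy) eqn_add2l.
Qed.

Lemma exec_shift d S c s k s' :
  exec c s k s' -> exec (shift_cmd d c) (above d S s) k (above d S s').
Proof.
elim=> {c s k s'} /= [s|s x e|c1 c2 s1 k1 s2 k2 s3 _ IH1 _ IH2
  |x c1 c2 s k s' sx _ IH|x c1 c2 s k s' sx _ IH|x c s sx
  |x c s1 k1 s2 k2 s3 sx _ IH1 _ IH2].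
- exact: exec_skip.
- rewrite -update_shift -(eval_shift d S); exact: exec_assign.
- exact: exec_seq IH1 IH2.
- by apply: exec_if_true IH; rewrite above_shift.
- by apply: exec_if_false IH; rewrite above_shift.
- by apply: exec_while_stop; rewrite above_shift.
- by apply: exec_while_step IH1 IH2; rewrite above_shift.
Qed.

Lemma above_st l t : above (size l) (st l) (st [:: t]) = st (rcons l t).
Proof.
apply: funext => y; rewrite /above /st nth_rcons.
case: ltngtP => [//|lt_ly|->]; last by rewrite subnn.
by rewrite nth_default //= subn_gt0.
Qed.

(** An assignment is charged more than the size of what it stores, so a new tree is never larger
    than the time spent. This is what makes outputs of polynomial-time programs polynomially large,
    hence composable. *)
Lemma exec_size M c s k s' :
  exec c s k s' -> (forall y, tree_size (s y) <= M) ->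
  forall y, tree_size (s' y) <= M + k.
Proof.
move=> ex; elim: ex M => {c s k s'} /= [s|s x e
  |c1 c2 s1 k1 s2 k2 s3 _ IH1 _ IH2|x c1 c2 s k s' sx _ IH
  |x c1 c2 s k s' sx _ IH|x c s sx
  |x c s1 k1 s2 k2 s3 sx _ IH1 _ IH2] M sM y.
- exact: leq_trans (sM y) (leq_addr _ _).
- rewrite /update; case: eqP => _; last exact: leq_trans (sM y) (leq_addr _ _).
  by rewrite addnS ltnW // ltnS leq_addl.
- by rewrite addnA; apply: IH2 => z; apply: IH1.
- by rewrite addnS; apply: leqW; apply: IH.
- by rewrite addnS; apply: leqW; apply: IH.
- exact: leq_trans (sM y) (leq_addr _ _).
- by rewrite addnS addnA; apply: leqW; apply: IH2 => z; apply: IH1.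
Qed.

Definition run c s s' n := exists2 k, exec c s k s' & k <= n.

Lemma run_seq c1 c2 s1 s2 s3 n1 n2 :
  run c1 s1 s2 n1 -> run c2 s2 s3 n2 -> run (Seq c1 c2) s1 s3 (n1 + n2).
Proof.
move=> [k1 ex1 le1] [k2 ex2 le2]; exists (k1 + k2); last exact: leq_add.
exact: exec_seq ex1 ex2.
Qed.

Lemma run_le c s s' m n : run c s s' m -> m <= n -> run c s s' n.
Proof. by move=> [k ex le_km] le_mn; exists k => //; apply: leq_trans le_mn. Qed.

Lemma run_assign l x e :
  run (Assign x e) (st l) (st (set_nth Leaf l x (eval (st l) e)))
      (tree_size (eval (st l) e)).+1.
Proof. by eexists; [rewrite -update_st; apply: exec_assign|]. Qed.

Lemma run_call l c t u n :
  run c (st [:: t]) (st [:: u]) n ->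
  run (shift_cmd (size l) c) (st (rcons l t)) (st (rcons l u)) n.
Proof. by move=> [k ex le]; exists k => //; rewrite -!above_st; apply: exec_shift. Qed.

(** * Functions computed in polynomial time on encoded data *)

Class Enc (T : Type) := enc : T -> tree.

#[export] Instance enc_bool_inst : Enc bool := enc_bool.
#[export] Instance enc_nat_inst : Enc nat := enc_nat.
#[export] Instance enc_pair_inst A B (eA : Enc A) (eB : Enc B) : Enc (A * B) :=
  fun p => Node (enc p.1) (enc p.2).
#[export] Instance enc_seq_inst A (eA : Enc A) : Enc (seq A) :=
  fun s => enc_list (map enc s).

Definition esz T (eT : Enc T) (x : T) : nat := tree_size (enc x).
Arguments esz {T eT} x.

Lemma esz_gt0 T (eT : Enc T) (x : T) : 0 < esz x.
Proof. by rewrite /esz; case: (enc x). Qed.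

(** The final store is prescribed entirely, not only in variable 0: a program leaves no garbage and
    can be followed by another one. *)
Definition ptime A B (eA : Enc A) (eB : Enc B) (f : A -> B) : Prop :=
  exists c p, forall x,
    run c (st [:: enc x]) (st [:: enc (f x)]) (pev p (esz x)).
Arguments ptime {A B eA eB} f.

Lemma ptime_esz A B (eA : Enc A) (eB : Enc B) (f : A -> B) :
  ptime f -> exists p, forall x, esz (f x) <= pev p (esz x).
Proof.
move=> [c [p run_f]]; exists (p + 'X)%R => x; rewrite !pevE addnC.
have [k ex le_k] := run_f x; apply: leq_trans (leq_add (leqnn _) le_k).
apply: (exec_size ex _ 0) => -[|y] //=.
by rewrite /st /= nth_nil /= esz_gt0.
Qed.

(** Programs see only codes, so a function may be retyped along equal encodings; this is how a
    number and its list of bits are identified. *)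
Lemma pt_enc A B C D (eA : Enc A) (eB : Enc B) (eC : Enc C) (eD : Enc D)
    (f : A -> B) (h : C -> A) (g : C -> D) :
  ptime f -> (forall x, enc (h x) = enc x) ->
  (forall x, enc (g x) = enc (f (h x))) -> ptime g.
Proof.
by move=> [c [p run_f]] eh eg; exists c, p => x; move: (run_f (h x)); rewrite /esz eh eg.
Qed.

Lemma pt_expr A B (eA : Enc A) (eB : Enc B) (f : A -> B) e n :
  (forall x, eval (st [:: enc x]) e = enc (f x)) ->
  (forall x, esz (f x) <= esz x + n) -> ptime f.
Proof.
move=> ef sf; exists (Assign 0 e), ('X + pconst n.+1)%R => x.
have := run_assign [:: @enc _ eA x] 0 e; rewrite ef /= => r; apply: run_le r _.
by rewrite !pevE addnS ltnS sf.
Qed.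

Lemma pt_id A (eA : Enc A) : ptime (fun x : A => x).
Proof. by apply: (@pt_expr _ _ _ _ _ (EVar 0) 0) => // x; rewrite addn0. Qed.

Lemma pt_const A B (eA : Enc A) (eB : Enc B) (b : B) : ptime (fun _ : A => b).
Proof.
pose fix tex t := if t is Node l r then ENode (tex l) (tex r) else ELeaf.
apply: (@pt_expr _ _ _ _ _ (tex (enc b)) (esz b)) => x; last exact: leq_addl.
by elim: (enc b) => //= l -> r ->.
Qed.

Lemma pt_comp A B C (eA : Enc A) (eB : Enc B) (eC : Enc C) (f : A -> B)
    (g : B -> C) :
  ptime f -> ptime g -> ptime (fun x => g (f x)).
Proof.
move=> pf [cg [pg run_g]]; have [q sz_f] := ptime_esz pf.
have [cf [p run_f]] := pf.
exists (Seq cf cg), (p + (pg \Po q))%R => x; rewrite !pevE.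
apply: run_seq (run_f x) _; apply: run_le (run_g _) _.
exact: pev_mono.
Qed.

Lemma pt_pair A B C (eA : Enc A) (eB : Enc B) (eC : Enc C) (f : A -> B)
    (g : A -> C) :
  ptime f -> ptime g -> ptime (fun x => (f x, g x)).
Proof.
move=> pf pg; have [q sz_f] := ptime_esz pf; have [r sz_g] := ptime_esz pg.
have [cf [p run_f]] := pf; have [cg [p' run_g]] := pg.
(* Variable 0 keeps the argument while variables 1 and 2 are turned into the two results; both are
   cleared at the end. *)
exists (Seq (Assign 1 (EVar 0)) (Seq (shift_cmd 1 cf)
  (Seq (Assign 2 (EVar 0)) (Seq (shift_cmd 2 cg)
  (Seq (Assign 0 (ENode (EVar 1) (EVar 2)))
  (Seq (Assign 1 ELeaf) (Assign 2 ELeaf))))))),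
  (('X + pconst 1) + (p + (('X + pconst 1) + (p' + ((q + r + pconst 2) + (pconst 2 + pconst 2))))))%R.
move=> x; rewrite !pevE.
apply: run_seq; first by apply: run_le (run_assign _ _ _) _; rewrite /= addn1.
apply: run_seq; first exact: (@run_call [:: _] _ _ _ _ (run_f x)).
apply: run_seq; first by apply: run_le (run_assign _ _ _) _; rewrite /= addn1.
apply: run_seq; first exact: (@run_call [:: _; _] _ _ _ _ (run_g x)).
apply: run_seq.
  by apply: run_le (run_assign _ _ _) _; rewrite /= addn2 !ltnS leq_add ?sz_f ?sz_g.
apply: run_seq; first exact: run_assign.
have := run_assign [:: Node (@enc _ eB (f x)) (@enc _ eC (g x)); Leaf; @enc _ eC (g x)] 2 ELeaf.
by rewrite /= (st_rcons_leaf [:: _; _]) (st_rcons_leaf [:: _]).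
Qed.

Lemma pt_if A B (eA : Enc A) (eB : Enc B) (b : A -> bool) (f g : A -> B) :
  ptime b -> ptime f -> ptime g -> ptime (fun x => if b x then f x else g x).
Proof.
move=> [cb [p run_b]] [cf [q run_f]] [cg [r run_g]].
exists (Seq (Assign 1 (EVar 0)) (Seq (shift_cmd 1 cb)
  (If 1 (Seq (Assign 1 ELeaf) cf) (Seq (Assign 1 ELeaf) cg)))),
  (('X + pconst 1) + (p + (pconst 3 + (q + r))))%R.
move=> x; rewrite !pevE.
apply: run_seq; first by apply: run_le (run_assign _ _ _) _; rewrite /= addn1.
apply: run_seq; first exact: (@run_call [:: _] _ _ _ _ (run_b x)).
have clr v : run (Assign 1 ELeaf) (st [:: enc x; v]) (st [:: enc x]) 2.
  by have := run_assign [:: @enc _ eA x; v] 1 ELeaf; rewrite /= (st_rcons_leaf [:: _]).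
case bx: (b x).
  have [k ex le_k] := run_seq (clr (enc true)) (run_f x); exists k.+1; last by lia.
  by apply: exec_if_true ex.
have [k ex le_k] := run_seq (clr (enc false)) (run_g x); exists k.+1; last by lia.
by apply: exec_if_false ex.
Qed.

Lemma esz_cons A (eA : Enc A) (a : A) s : esz (a :: s) = (esz a + esz s).+1.
Proof. by []. Qed.

Lemma esz_pair A B (eA : Enc A) (eB : Enc B) (a : A) (b : B) :
  esz (a, b) = (esz a + esz b).+1.
Proof. by []. Qed.

Lemma size_esz A (eA : Enc A) (s : seq A) : size s < esz s.
Proof. by elim: s => //= a s IHs; rewrite esz_cons !ltnS (leq_trans IHs) ?leq_addl. Qed.

Lemma esz_cat A (eA : Enc A) (s1 s2 : seq A) :
  (esz (s1 ++ s2)).+1 = esz s1 + esz s2.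
Proof. by elim: s1 => //= a s1 IH; rewrite !esz_cons -addnS IH addnA. Qed.

Lemma esz_drop A (eA : Enc A) n (s : seq A) : esz (drop n s) <= esz s.
Proof.
elim: s n => [|a s IH] [|n] //=; rewrite esz_cons.
exact: leq_trans (IH n) (leqW (leq_addl _ _)).
Qed.

(** Iterating a polynomial-time step may square the accumulator each time, so a polynomial bound on
    the accumulator after every prefix is part of the hypotheses. *)
Lemma pt_foldl E A B (eE : Enc E) (eA : Enc A) (eB : Enc B)
    (f : E -> B -> A -> B) (i : E -> B) (l : E -> seq A) :
  ptime (fun p : E * (B * A) => f p.1 p.2.1 p.2.2) -> ptime i -> ptime l ->
  (exists q, forall e n, esz (foldl (f e) (i e) (take n (l e))) <= pev q (esz e)) ->
  ptime (fun e => foldl (f e) (i e) (l e)).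
Proof.
move=> [cf [p run_f]] pi pl [q sz_f].
have [r sz_l] := ptime_esz pl.
have [ci [pi' run_i]] := pi; have [cl [pl' run_l]] := pl.
(* Variable 0 holds the parameter, 1 the accumulator, 2 the remaining list, and 3 the argument of
   the step. *)
pose body := Seq (Assign 3 (ENode (EVar 0) (ENode (EVar 1) (ELeft (EVar 2)))))
  (Seq (shift_cmd 3 cf) (Seq (Assign 1 (EVar 3))
  (Seq (Assign 3 ELeaf) (Assign 2 (ERight (EVar 2)))))).
pose arg := ('X + q + r + pconst 2)%R : {poly nat}.
pose bb := ((arg + pconst 1) + ((p \Po arg) + ((q + pconst 1) + (pconst 2 + (r + pconst 1)))))%R
  : {poly nat}.
exists (Seq (Assign 1 (EVar 0)) (Seq (shift_cmd 1 ci)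
  (Seq (Assign 2 (EVar 0)) (Seq (shift_cmd 2 cl)
  (Seq (While 2 body) (Seq (Assign 0 (EVar 1)) (Assign 1 ELeaf))))))),
  (('X + pconst 1) + (pi' + (('X + pconst 1) + (pl' + ((r * (bb + pconst 1) + pconst 1)
    + ((q + pconst 1) + pconst 2))))))%R.
move=> e; have esz_acc n := sz_f e n.
(* Induction on the number [n] of remaining elements. The empty list is encoded as [Leaf] and every
   other list as a [Node], so testing variable 2 ends the loop. *)
have loop n : n <= size (l e) ->
  run (While 2 body)
    (st [:: enc e; enc (foldl (f e) (i e) (take (size (l e) - n) (l e)));
            enc (drop (size (l e) - n) (l e))])
    (st [:: enc e; enc (foldl (f e) (i e) (l e))])
    (n * (pev bb (esz e)).+1).+1.
  elim: n => [|n IHn] le_n.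
    rewrite subn0 take_size drop_size mul0n; exists 1 => //.
    rewrite (st_rcons_leaf [:: _; _]).
    exact: exec_while_stop.
  have lt_n : size (l e) - n.+1 < size (l e) by lia.
  have [a [s' def_s]] : exists a s', drop (size (l e) - n.+1) (l e) = a :: s'.
    case E0: (drop _ _) => [|a s']; last by exists a, s'.
    by move: (size_drop (size (l e) - n.+1) (l e)); rewrite E0 /=; lia.
  have eqS : size (l e) - n = (size (l e) - n.+1).+1 by lia.
  have nth_a : nth a (l e) (size (l e) - n.+1) = a.
    by rewrite -[in LHS](addn0 (_ - _)) -nth_drop def_s.
  have def_s' : drop (size (l e) - n) (l e) = s'.
    by rewrite eqS -addn1 addnC -drop_drop def_s /= drop0.
  have def_t : take (size (l e) - n) (l e) = rcons (take (size (l e) - n.+1) (l e)) a.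
    by rewrite eqS (take_nth a) // nth_a.
  have sz_as : (esz a + esz s').+1 <= pev r (esz e).
    by rewrite -esz_cons -def_s (leq_trans (esz_drop _ _ _)).
  move: (IHn (ltnW le_n)); rewrite def_s' def_t foldl_rcons def_s => run_loop.
  set acc := foldl _ _ _ in run_loop *.
  have sz_acc : esz acc <= pev q (esz e) by apply: esz_acc.
  have sz_acc' : esz (f e acc a) <= pev q (esz e).
    by rewrite -foldl_rcons -def_t; apply: esz_acc.
  have run_body : run body (st [:: enc e; enc acc; enc (a :: s')])
      (st [:: enc e; enc (f e acc a); enc s']) (pev bb (esz e)).
    have le_arg : esz (e, (acc, a)) <= pev arg (esz e).
      by rewrite !esz_pair !pevE; lia.
    rewrite !pevD !pevC pev_comp.
    apply: run_seq.
      apply: run_le (run_assign _ _ _) _.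
      by move: le_arg; rewrite /esz /= !pevE; lia.
    apply: run_seq.
      apply: run_le (@run_call [:: _; _; _] _ _ _ _ (run_f (e, (acc, a)))) _.
      exact: pev_mono.
    apply: run_seq.
      by apply: run_le (run_assign _ _ _) _; rewrite /= addn1 ltnS.
    apply: run_seq.
      exact: run_assign.
    have -> : st [:: enc e; enc (f e acc a); enc s']
              = st [:: enc e; enc (f e acc a); enc s'; Leaf].
      by rewrite -[LHS]st_rcons_leaf.
    apply: run_le (run_assign _ _ _) _.
    by rewrite addn1 ltnS; apply: leq_trans sz_as; apply: leqW (leq_addl _ _).
  have [k2 ex2 le2] := run_loop; have [k1 ex1 le1] := run_body.
  exists (k1 + k2).+1; last by rewrite mulSn; lia.
  exact: exec_while_step ex1 ex2.
have [pb def_pb] : exists pb, pb = bb by exists bb.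
rewrite -def_pb in loop *; rewrite !pevD !pevM !pevD !pevC pevX.
apply: run_seq; first by apply: run_le (run_assign _ _ _) _; rewrite /= addn1.
apply: run_seq; first exact: (@run_call [:: _] _ _ _ _ (run_i e)).
apply: run_seq; first by apply: run_le (run_assign _ _ _) _; rewrite /= addn1.
apply: run_seq; first exact: (@run_call [:: _; _] _ _ _ _ (run_l e)).
apply: run_seq.
  have := loop _ (leqnn _); rewrite subnn take0 drop0 => run_loop.
  apply: run_le run_loop _; rewrite addn1 ltnS leq_mul ?addn1 //.
  exact: leq_trans (ltnW (size_esz _ _)) (sz_l e).
have sz_res : esz (foldl (f e) (i e) (l e)) <= pev q (esz e).
  by have := esz_acc (size (l e)); rewrite take_size.
apply: run_seq.
  by apply: run_le (run_assign _ _ _) _; rewrite /= addn1 ltnS.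
set y := enc (foldl _ _ _).
by have := run_assign [:: y; y] 1 ELeaf; rewrite /= (st_rcons_leaf [:: _]).
Qed.

(** * Lists and binary numbers *)

Lemma pt_ext A B (eA : Enc A) (eB : Enc B) (f g : A -> B) :
  ptime f -> f =1 g -> ptime g.
Proof. by move=> pf fg; apply: (pt_enc pf (h := id)) => // x; rewrite fg. Qed.

Lemma pt_fst X A B (eX : Enc X) (eA : Enc A) (eB : Enc B) (f : X -> A * B) :
  ptime f -> ptime (fun x => (f x).1).
Proof.
move=> pf; apply: (pt_comp pf (g := fst)).
apply: (@pt_expr _ _ _ _ _ (ELeft (EVar 0)) 0) => [[a b]//|[a b]].
by rewrite addn0 esz_pair ltnW // ltnS leq_addr.
Qed.

Lemma pt_snd X A B (eX : Enc X) (eA : Enc A) (eB : Enc B) (f : X -> A * B) :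
  ptime f -> ptime (fun x => (f x).2).
Proof.
move=> pf; apply: (pt_comp pf (g := snd)).
apply: (@pt_expr _ _ _ _ _ (ERight (EVar 0)) 0) => [[a b]//|[a b]].
by rewrite addn0 esz_pair ltnW // ltnS leq_addl.
Qed.

Lemma pt_app2 X A B C (eX : Enc X) (eA : Enc A) (eB : Enc B) (eC : Enc C)
    (h : A -> B -> C) (f : X -> A) (g : X -> B) :
  ptime (fun p : A * B => h p.1 p.2) -> ptime f -> ptime g ->
  ptime (fun x => h (f x) (g x)).
Proof. by move=> ph pf pg; apply: (pt_comp (pt_pair pf pg) ph). Qed.

Lemma pt_cons X A (eX : Enc X) (eA : Enc A) (f : X -> A) (s : X -> seq A) :
  ptime f -> ptime s -> ptime (fun x => f x :: s x).
Proof.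
move=> pf ps; apply: (pt_app2 _ pf ps).
by apply: (@pt_expr _ _ _ _ _ (EVar 0) 0) => // -[a b]; rewrite addn0.
Qed.

Lemma pt_behead X A (eX : Enc X) (eA : Enc A) (s : X -> seq A) :
  ptime s -> ptime (fun x => behead (s x)).
Proof.
move=> ps; apply: (pt_comp ps); apply: (@pt_expr _ _ _ _ _ (ERight (EVar 0)) 0).
  by case.
by case=> [//|a l] /=; rewrite addn0 esz_cons ltnW // ltnS leq_addl.
Qed.

Lemma pt_head_bool X (eX : Enc X) (s : X -> seq bool) :
  ptime s -> ptime (fun x => head false (s x)).
Proof.
move=> ps; apply: (pt_comp ps); apply: (@pt_expr _ _ _ _ _ (ELeft (EVar 0)) 0).
  by case.
by case=> [//|a l] /=; rewrite addn0 esz_cons ltnW // ltnS leq_addr.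
Qed.

Lemma pt_nilp X A (eX : Enc X) (eA : Enc A) (s : X -> seq A) :
  ptime s -> ptime (fun x => nilp (s x)).
Proof.
move=> ps; apply: (pt_comp ps).
exists (If 0 (Assign 0 ELeaf) (Assign 0 (ENode ELeaf ELeaf))), (pconst 5)%R => l.
rewrite pevC; case: l => [|a l] /=.
  have [k ex le] := run_assign [:: Leaf] 0 (ENode ELeaf ELeaf).
  by exists k.+1 => //; apply: exec_if_false ex.
have [k ex le] := run_assign [:: @enc (seq A) _ (a :: l)] 0 ELeaf.
by exists k.+1; [apply: exec_if_true ex | move: le => /=; lia].
Qed.

Lemma pt_negb X (eX : Enc X) (b : X -> bool) : ptime b -> ptime (fun x => ~~ b x).
Proof. by move=> pb; apply: pt_if pb _ _; apply: pt_const. Qed.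

Lemma pt_andb X (eX : Enc X) (b c : X -> bool) :
  ptime b -> ptime c -> ptime (fun x => b x && c x).
Proof. by move=> pb pc; apply: (pt_if (g := fun=> false)) pb pc _; apply: pt_const. Qed.

Lemma pt_orb X (eX : Enc X) (b c : X -> bool) :
  ptime b -> ptime c -> ptime (fun x => b x || c x).
Proof. by move=> pb pc; apply: (pt_if (f := fun=> true)) pb _ pc; apply: pt_const. Qed.

Lemma pt_addb X (eX : Enc X) (b c : X -> bool) :
  ptime b -> ptime c -> ptime (fun x => b x (+) c x).
Proof. move=> pb pc; apply: pt_ext (pt_if pb (pt_negb pc) pc) _ => x.
by case: (b x). Qed.

Ltac pt1 :=
  lazymatch goal with
  | |- @ptime _ _ _ _ (fun x => x) => apply: pt_id
  | |- @ptime _ _ _ _ (fun x => @fst _ _ _) => apply: pt_fst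
  | |- @ptime _ _ _ _ (fun x => @snd _ _ _) => apply: pt_snd
  | |- @ptime _ _ _ _ (@fst _ _) => exact: (pt_fst (pt_id _))
  | |- @ptime _ _ _ _ (@snd _ _) => exact: (pt_snd (pt_id _))
  | |- @ptime _ _ _ _ (fun x => @pair _ _ _ _) => apply: pt_pair
  | |- @ptime _ _ _ _ (fun x => @cons _ _ _) => apply: pt_cons
  | |- @ptime _ _ _ _ (fun x => behead _) => apply: pt_behead
  | |- @ptime _ _ _ _ (fun x => head false _) => apply: pt_head_bool
  | |- @ptime _ _ _ _ (fun x => nilp _) => apply: pt_nilp
  | |- @ptime _ _ _ _ (fun x => ~~ _) => apply: pt_negb
  | |- @ptime _ _ _ _ (fun x => _ && _) => apply: pt_andb
  | |- @ptime _ _ _ _ (fun x => _ || _) => apply: pt_orb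
  | |- @ptime _ _ _ _ (fun x => _ (+) _) => apply: pt_addb
  | |- @ptime _ _ _ _ (fun x => if _ then _ else _) => apply: pt_if
  | |- @ptime _ _ _ _ (fun x => ?b) => apply: pt_const
  end.

Ltac pt := cbn beta; repeat first [assumption | pt1].

Lemma foldl_esz A B (eA : Enc A) (eB : Enc B) (f : B -> A -> B) b s M c :
  (forall b a, esz a <= M -> esz (f b a) <= esz b + c) -> esz s <= M ->
  esz (foldl f b s) <= esz b + size s * c.
Proof.
move=> sz_f; elim: s b => [|a s IHs] b /=; first by rewrite mul0n addn0.
rewrite esz_cons => le_as; rewrite mulSn addnA.
apply: leq_trans (IHs _ _) _; first by lia.
by rewrite leq_add2r; apply: sz_f; lia.
Qed.

Lemma esz_take A (eA : Enc A) n (s : seq A) : esz (take n s) <= esz s.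
Proof. by elim: s n => [|a s IH] [|n] //=; rewrite !esz_cons ltnS leq_add2l. Qed.

(** Convenient criterion: if the growth caused by one step does not depend on the accumulator, the
    growths add up to a polynomial. *)
Lemma pt_foldl_add E A B (eE : Enc E) (eA : Enc A) (eB : Enc B)
    (f : E -> B -> A -> B) (i : E -> B) (l : E -> seq A) :
  ptime (fun p : E * (B * A) => f p.1 p.2.1 p.2.2) -> ptime i -> ptime l ->
  (exists q, forall e b a, esz (f e b a) <= esz b + pev q (esz e + esz a)) ->
  ptime (fun e => foldl (f e) (i e) (l e)).
Proof.
move=> pf pi pl [q sz_f]; apply: (pt_foldl pf pi pl _).
have [r sz_i] := ptime_esz pi; have [t sz_l] := ptime_esz pl.
exists (r + t * (q \Po ('X + t)))%R => e n; rewrite !pevE.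
apply: leq_trans
  (foldl_esz (M := pev t (esz e)) (c := pev q (esz e + pev t (esz e))) _ _ _) _.
- move=> b a le_a; apply: leq_trans (sz_f _ _ _) _.
  by rewrite leq_add2l pev_mono // leq_add2l.
- exact: leq_trans (esz_take _ _ _) (sz_l e).
- apply: leq_add (sz_i e) _; rewrite leq_mul2r; apply/orP; right.
  apply: leq_trans (sz_l e); apply: leq_trans (ltnW (size_esz _ _)).
  by rewrite size_take_min geq_minr.
Qed.

Lemma pt_catrev X A (eX : Enc X) (eA : Enc A) (s t : X -> seq A) :
  ptime s -> ptime t -> ptime (fun x => catrev (s x) (t x)).
Proof.
move=> ps pt; apply: (@pt_ext _ _ _ _ (fun x => foldl (fun acc a => a :: acc) (t x) (s x))).
  apply: (pt_foldl_add _ pt ps _).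
    by pt.
  by exists ('X + pconst 1)%R => e b a; rewrite !pevE esz_cons; lia.
by move=> x; elim: (s x) (t x) => //= a l IH acc; rewrite IH.
Qed.

Lemma pt_rev X A (eX : Enc X) (eA : Enc A) (s : X -> seq A) :
  ptime s -> ptime (fun x => rev (s x)).
Proof. by move=> ps; apply: pt_catrev ps _; apply: pt_const. Qed.

Lemma pt_cat X A (eX : Enc X) (eA : Enc A) (s t : X -> seq A) :
  ptime s -> ptime t -> ptime (fun x => s x ++ t x).
Proof.
move=> ps pt; apply: pt_ext (pt_catrev (pt_rev ps) pt) _ => x.
by rewrite catrevE revK.
Qed.

Lemma pt_map X A B (eX : Enc X) (eA : Enc A) (eB : Enc B) (f : X -> A -> B)
    (s : X -> seq A) :
  ptime (fun p : X * A => f p.1 p.2) -> ptime s ->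
  ptime (fun x => [seq f x a | a <- s x]).
Proof.
move=> pf ps; have [q sz_f] := ptime_esz pf.
apply: (@pt_ext _ _ _ _
  (fun x => rev (foldl (fun acc a => f x a :: acc) [::] (s x)))).
  apply: pt_rev; apply: (pt_foldl_add _ (pt_const _ _ _) ps).
    apply: pt_cons; last by apply: pt_fst; apply: pt_snd; apply: pt_id.
    apply: pt_app2 pf _ _; first by apply: pt_fst; apply: pt_id.
    by apply: pt_snd; apply: pt_snd; apply: pt_id.
  exists ((q \Po ('X + pconst 1)) + pconst 1)%R => e b a; rewrite !pevE esz_cons.
  rewrite [X in pev q X](addn1 (esz e + esz a)).
  by have := sz_f (e, a); rewrite /= esz_pair; lia.
move=> x; have E acc : foldl (fun acc a => f x a :: acc) acc (s x)
    = catrev [seq f x a | a <- s x] acc.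
  by elim: (s x) acc => //= a l IH acc.
by rewrite E -/(rev _) revK.
Qed.

Lemma pt_flatten X A (eX : Enc X) (eA : Enc A) (s : X -> seq (seq A)) :
  ptime s -> ptime (fun x => flatten (s x)).
Proof.
move=> ps; apply: (@pt_ext _ _ _ _ (fun x => foldl cat [::] (s x))).
  apply: (pt_foldl_add _ (pt_const _ _ _) ps).
    by apply: pt_cat; pt.
  by exists 'X%R => e b a; rewrite !pevE; have := esz_cat eA b a; lia.
move=> x; rewrite -[RHS]cat0s; elim: (s x) [::] => /= [|a l IH] acc.
  by rewrite cats0.
by rewrite IH catA.
Qed.

Lemma pt_filter X A (eX : Enc X) (eA : Enc A) (b : X -> A -> bool)
    (s : X -> seq A) :
  ptime (fun p : X * A => b p.1 p.2) -> ptime s ->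
  ptime (fun x => [seq a <- s x | b x a]).
Proof.
move=> pb ps.
apply: (@pt_ext _ _ _ _
  (fun x => flatten [seq (if b x a then [:: a] else [::]) | a <- s x])).
  apply: pt_flatten; apply: pt_map ps; apply: pt_if pb _ _.
    by apply: pt_cons (pt_const _ _ _); apply: pt_snd; apply: pt_id.
  exact: pt_const.
by move=> x; elim: (s x) => //= a l IH; case: (b x a); rewrite /= IH.
Qed.

Lemma pt_has X A (eX : Enc X) (eA : Enc A) (b : X -> A -> bool)
    (s : X -> seq A) :
  ptime (fun p : X * A => b p.1 p.2) -> ptime s ->
  ptime (fun x => has (b x) (s x)).
Proof.
move=> pb ps; apply: (@pt_ext _ _ _ _ (fun x => ~~ nilp [seq a <- s x | b x a])).
  by apply: pt_negb; apply: pt_nilp; apply: pt_filter.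
by move=> x /=; rewrite has_count -size_filter lt0n.
Qed.

Lemma pt_all X A (eX : Enc X) (eA : Enc A) (b : X -> A -> bool)
    (s : X -> seq A) :
  ptime (fun p : X * A => b p.1 p.2) -> ptime s ->
  ptime (fun x => all (b x) (s x)).
Proof.
move=> pb ps; apply: (@pt_ext _ _ _ _ (fun x => ~~ has (fun a => ~~ b x a) (s x))).
  by apply: pt_negb; apply: pt_has ps; apply: pt_negb.
by move=> x /=; rewrite -all_predC; apply: eq_all => a /=; rewrite negbK.
Qed.

Lemma pt_allpairs X A B C (eX : Enc X) (eA : Enc A) (eB : Enc B) (eC : Enc C)
    (f : X -> A -> B -> C) (s : X -> seq A) (t : X -> seq B) :
  ptime (fun p : (X * A) * B => f p.1.1 p.1.2 p.2) -> ptime s -> ptime t ->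
  ptime (fun x => [seq f x a b | a <- s x, b <- t x]).
Proof.
move=> pf ps pt; apply: pt_flatten; apply: (pt_map (f := fun x a => map (f x a) (t x))) ps.
apply: (pt_map (X := (X * A)%type) (f := fun p => f p.1 p.2)) pf _.
by apply: (pt_comp (f := fst)) pt; apply: pt_fst; apply: pt_id.
Qed.

(** * Binary arithmetic *)

Definition bits_val (l : seq bool) : nat := foldr (fun (b : bool) n => b + n.*2) 0 l.

(** Drops the most significant zeros, which stand at the end of the list; the result is the
    canonical form used by [nat_bits]. *)
Definition norm_bits (l : seq bool) : seq bool :=
  foldr (fun (b : bool) s => if b || ~~ nilp s then b :: s else [::]) [::] l.

Lemma nat_bits_step (b : bool) n :
  nat_bits (b + n.*2) = if b || (n != 0) then b :: nat_bits n else [::].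
Proof.
rewrite /nat_bits; have := bin_of_natK n; case: (bin_of_nat n) => [|p] <-.
  by case: b.
have -> : nat_of_bin (BinNums.Npos p) != 0.
  by elim: p => //= p; rewrite /= ?NatTrec.doubleE; lia.
rewrite orbT.
case: b.
  suff -> : true + (nat_of_bin (BinNums.Npos p)).*2 = nat_of_bin (BinNums.Npos (BinNums.xI p)).
    by rewrite nat_of_binK.
  by rewrite /= NatTrec.doubleE.
suff -> : false + (nat_of_bin (BinNums.Npos p)).*2 = nat_of_bin (BinNums.Npos (BinNums.xO p)).
  by rewrite nat_of_binK.
by rewrite /= NatTrec.doubleE.
Qed.

Lemma nat_bits_eq0 n : nilp (nat_bits n) = (n == 0).
Proof.
by rewrite -[n]odd_double_half nat_bits_step; case: (odd n) => //; case: (n./2).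
Qed.

Lemma nat_bits_val l : nat_bits (bits_val l) = norm_bits l.
Proof. by elim: l => //= b l IH; rewrite nat_bits_step IH -IH nat_bits_eq0. Qed.

Lemma bits_valK n : bits_val (nat_bits n) = n.
Proof.
elim/ltn_ind: n => n IH; rewrite -[in nat_bits n](odd_double_half n) nat_bits_step.
have [->|n_gt0] := posnP n; first by [].
have -> : odd n || (n./2 != 0) by case: n n_gt0 {IH} => [|[|n]] //= _; rewrite orbT.
rewrite /= IH ?odd_double_half // -divn2; exact: ltn_Pdiv.
Qed.

Lemma size_nat_bits_leq n k : (size (nat_bits n) <= k) = (n < 2 ^ k).
Proof.
elim: k n => [|k IH] n; first by rewrite leqn0 expn0 ltnS leqn0 -[RHS]nat_bits_eq0.
rewrite -{1}(odd_double_half n) nat_bits_step.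
have [/= _|] := boolP (odd n || _); first by rewrite ltnS IH expnS; lia.
rewrite negb_or negbK => /andP[/negbTE n_even /eqP n0].
by rewrite leq0n -(odd_double_half n) n_even n0 expn_gt0.
Qed.

Lemma size_nat_bits_mono m n : m <= n -> size (nat_bits m) <= size (nat_bits n).
Proof.
move=> le_mn; rewrite size_nat_bits_leq (leq_ltn_trans le_mn) //.
by rewrite -size_nat_bits_leq.
Qed.

Lemma size_nat_bits_add m n :
  size (nat_bits (m + n)) <= size (nat_bits m) + size (nat_bits n).
Proof.
have [->|m_gt0] := posnP m; first by rewrite leq_addl.
have [->|n_gt0] := posnP n; first by rewrite addn0 leq_addr.
rewrite size_nat_bits_leq expnD.
have := leqnn (size (nat_bits m)); rewrite size_nat_bits_leq.
have := leqnn (size (nat_bits n)); rewrite size_nat_bits_leq.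
set x := 2 ^ _; set y := 2 ^ _ => lt_n lt_m; nia.
Qed.

Lemma esz_nat_ge n : (size (nat_bits n)).*2 < esz n.
Proof.
rewrite /esz /enc /enc_nat_inst /enc_nat.
by elim: (nat_bits n) => //= b l IH; case: b => /=; lia.
Qed.

Lemma esz_nat_le n : esz n <= (4 * size (nat_bits n)).+1.
Proof.
rewrite /esz /enc /enc_nat_inst /enc_nat.
by elim: (nat_bits n) => //= b l IH; case: b => /=; lia.
Qed.

(** The factor 2 is there because the code is not monotone: a one bit takes twice the space of a
    zero bit, so 7 has a larger code than 8. *)
Lemma esz_nat_mono m n : m <= n -> esz m <= 2 * esz n.
Proof.
move=> /size_nat_bits_mono le_mn.
by have := esz_nat_le m; have := esz_nat_ge n; lia.
Qed.

Lemma pt_nat_bits X (eX : Enc X) (f : X -> nat) :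
  ptime f -> ptime (fun x => nat_bits (f x)).
Proof. by move=> pf; apply: (pt_enc pf (h := id)). Qed.

Lemma pt_bits_val X (eX : Enc X) (f : X -> seq bool) :
  ptime f -> ptime (fun x => bits_val (f x)).
Proof.
move=> pf; apply: (@pt_enc _ _ _ _ _ _ _ _ (fun x => norm_bits (f x)) id) => //; last first.
  by move=> x; rewrite /enc /enc_nat_inst /enc_nat nat_bits_val.
apply: (@pt_ext _ _ _ _ (fun x =>
  foldl (fun s b => if b || ~~ nilp s then b :: s else [::]) [::] (rev (f x)))).
  apply: (pt_foldl_add _ (pt_const _ _ _) (pt_rev pf)).
    have p1 : ptime (fun p : X * (seq bool * bool) => p.2.1).
      by apply: pt_fst; apply: pt_snd; apply: pt_id.
    have p2 : ptime (fun p : X * (seq bool * bool) => p.2.2).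
      by apply: pt_snd; apply: pt_snd; apply: pt_id.
    apply: pt_if (pt_const _ _ _); last exact: pt_cons.
    by apply: pt_orb => //; apply: pt_negb; apply: pt_nilp.
  exists ('X + pconst 1)%R => e b a; rewrite !pevE; case: ifP => _.
    by rewrite esz_cons; lia.
  by rewrite /esz /=; lia.
by move=> x /=; rewrite foldl_rev.
Qed.

(** Carry of a full adder; with the first argument negated, the borrow of a full subtractor. *)
Definition maj x y z := (x && y) || (z && (x || y)).

(* One position of the schoolbook addition ([neg = false]) or subtraction
   ([neg = true]); the state is ((carry, output reversed), remaining operands). *)
Definition ripple_step (neg : bool) (s : (bool * seq bool) * (seq bool * seq bool))
    (_ : bool) :=
  ((maj (neg (+) head false s.2.1) (head false s.2.2) s.1.1,
    (head false s.2.1 (+) head false s.2.2 (+) s.1.1) :: s.1.2),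
   (behead s.2.1, behead s.2.2)).

(** The list [r.1 ++ r.2] serves only as a clock that is long enough for both operands; bits missing
    in the shorter one read as [false]. *)
Definition ripple neg (r : seq bool * seq bool) :=
  (foldl (ripple_step neg) ((false, [::]), r) (r.1 ++ r.2)).1.

Lemma bits_val_cat l1 l2 : bits_val (l1 ++ l2) = bits_val l1 + 2 ^ size l1 * bits_val l2.
Proof.
by elim: l1 => [|b l IH] /=; rewrite ?mul1n // IH expnS; lia.
Qed.

Lemma bits_val_lt l : bits_val l < 2 ^ size l.
Proof. by elim: l => //= b l IH; rewrite expnS; case: b; lia. Qed.

Lemma bits_val_behead l : bits_val l = head false l + (bits_val (behead l)).*2.
Proof. by case: l. Qed.

Lemma ripple_stepP neg c o r1 r2 l :
  size r1 <= size l -> size r2 <= size l ->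
  exists c' outs,
  [/\ (foldl (ripple_step neg) ((c, o), (r1, r2)) l).1 = (c', catrev outs o),
      size outs = size l
    & if neg then bits_val outs + bits_val r2 + c = bits_val r1 + 2 ^ size l * c'
      else bits_val outs + 2 ^ size l * c' = bits_val r1 + bits_val r2 + c].
Proof.
elim: l c o r1 r2 => [|x l IH] c o r1 r2.
  rewrite !leqn0 !size_eq0 => /eqP-> /eqP->; exists c, [::]; split=> //.
  by case: neg => /=; lia.
move=> sz1 sz2 /=.
have sz1' : size (behead r1) <= size l by rewrite size_behead -subn1 leq_subLR.
have sz2' : size (behead r2) <= size l by rewrite size_behead -subn1 leq_subLR.
have [c' [outs [E sz_o V]]] := IH (maj (neg (+) head false r1) (head false r2) c)
  ((head false r1 (+) head false r2 (+) c) :: o) _ _ sz1' sz2'.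
exists c', ((head false r1 (+) head false r2 (+) c) :: outs).
split; [exact: E | by rewrite /= sz_o |].
rewrite (bits_val_behead r1) (bits_val_behead r2) /= expnS.
by move: V; rewrite /maj; case: neg {E IH}; case: c; case: (head false r1);
  case: (head false r2) => /=; nia.
Qed.

Lemma rippleP neg r1 r2 :
  exists c outs, ripple neg (r1, r2) = (c, rev outs) /\
  exists2 L, size outs = L &
    if neg then bits_val outs + bits_val r2 = bits_val r1 + 2 ^ L * c
    else bits_val outs + 2 ^ L * c = bits_val r1 + bits_val r2.
Proof.
have [||c [outs [E sz V]]] := @ripple_stepP neg false [::] r1 r2 (r1 ++ r2).
- by rewrite size_cat leq_addr.
- by rewrite size_cat leq_addl.
exists c, outs; split; first exact: E.
by exists (size (r1 ++ r2)) => //; case: neg V {E} => /=; rewrite addn0.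
Qed.

Lemma pt_ripple X (eX : Enc X) neg (f : X -> seq bool * seq bool) :
  ptime f -> ptime (fun x => ripple neg (f x)).
Proof.
move=> pf; apply: (pt_comp pf); rewrite /ripple; apply: pt_fst.
pose P := ((seq bool * seq bool) *
  (((bool * seq bool) * (seq bool * seq bool)) * bool))%type.
apply: (pt_foldl_add (f := fun _ => ripple_step neg)).
- have p0 : ptime (fun p : P => p.2.1) by apply: pt_fst; apply: pt_snd; apply: pt_id.
  have p1 : ptime (fun p : P => head false p.2.1.2.1).
    by apply: pt_head_bool; apply: pt_fst; apply: pt_snd.
  have p2 : ptime (fun p : P => head false p.2.1.2.2).
    by apply: pt_head_bool; apply: pt_snd; apply: pt_snd.
  have p3 : ptime (fun p : P => p.2.1.1.1) by apply: pt_fst; apply: pt_fst.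
  apply: pt_pair; apply: pt_pair.
  + have p4 : ptime (fun p : P => neg (+) head false p.2.1.2.1).
      by apply: pt_addb p1; apply: pt_const.
    by apply: pt_orb; apply: pt_andb => //; apply: pt_orb.
  + by apply: pt_cons; [do 2?apply: pt_addb | apply: pt_snd; apply: pt_fst].
  + by apply: pt_behead; apply: pt_fst; apply: pt_snd.
  + by apply: pt_behead; apply: pt_snd; apply: pt_snd.
- by apply: pt_pair (pt_const _ _ _) (pt_id _).
- by apply: pt_cat; [apply: pt_fst | apply: pt_snd]; apply: pt_id.
exists (pconst 7)%R => e [[c o] [r1 r2]] b; rewrite pevC /ripple_step /=.
rewrite !esz_pair esz_cons.
have eszb (x : bool) : 0 < esz x <= 3 by case: x.
have eszt (s : seq bool) : esz (behead s) <= esz s.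
  by case: s => //= x s; rewrite esz_cons; lia.
have := eszt r1; have := eszt r2.
have := eszb c; have := eszb (maj (neg (+) head false r1) (head false r2) c).
by have := eszb (head false r1 (+) head false r2 (+) c); lia.
Qed.

Lemma pt_addn X (eX : Enc X) (f g : X -> nat) :
  ptime f -> ptime g -> ptime (fun x => f x + g x).
Proof.
move=> pf pg; pose r x := ripple false (nat_bits (f x), nat_bits (g x)).
have pr : ptime r by apply: pt_ripple; apply: pt_pair; apply: pt_nat_bits.
apply: (@pt_ext _ _ _ _ (fun x => bits_val (rev ((r x).1 :: (r x).2)))).
  apply: pt_bits_val; apply: pt_rev; apply: pt_cons; first exact: pt_fst.
  exact: pt_snd.
move=> x; rewrite /r; have := rippleP false (nat_bits (f x)) (nat_bits (g x)).
move=> [c [outs [-> [L <- /=]]]].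
rewrite rev_cons revK -cats1 bits_val_cat /= addn0 => ->.
by rewrite !bits_valK.
Qed.

Lemma pt_subn X (eX : Enc X) (f g : X -> nat) :
  ptime f -> ptime g -> ptime (fun x => f x - g x).
Proof.
move=> pf pg; pose r x := ripple true (nat_bits (f x), nat_bits (g x)).
have pr : ptime r by apply: pt_ripple; apply: pt_pair; apply: pt_nat_bits.
(* A final borrow means [f x < g x], where the truncated difference is 0. *)
apply: (@pt_ext _ _ _ _ (fun x => bits_val (if (r x).1 then [::] else rev (r x).2))).
  apply: pt_bits_val; apply: pt_if (pt_const _ _ _) _; first exact: pt_fst.
  by apply: pt_rev; apply: pt_snd.
move=> x; rewrite /r; have := rippleP true (nat_bits (f x)) (nat_bits (g x)).
move=> [c [outs [-> [L <- /=]]]].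
rewrite !bits_valK revK; have := bits_val_lt outs.
by case: c => /=; rewrite ?muln1 ?muln0; lia.
Qed.

Lemma pt_leq X (eX : Enc X) (f g : X -> nat) :
  ptime f -> ptime g -> ptime (fun x => f x <= g x).
Proof.
move=> pf pg; apply: (@pt_ext _ _ _ _ (fun x => nilp (nat_bits (f x - g x)))).
  by apply: pt_nilp; apply: pt_nat_bits; apply: pt_subn.
by move=> x /=; rewrite nat_bits_eq0.
Qed.

Lemma pt_ltn X (eX : Enc X) (f g : X -> nat) :
  ptime f -> ptime g -> ptime (fun x => f x < g x).
Proof.
move=> pf pg; apply: (pt_ext (pt_negb (pt_leq pg pf))) => x /=.
by rewrite -ltnNge.
Qed.

Lemma pt_eqn X (eX : Enc X) (f g : X -> nat) :
  ptime f -> ptime g -> ptime (fun x => f x == g x).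
Proof.
move=> pf pg; apply: (pt_ext (pt_andb (pt_leq pf pg) (pt_leq pg pf))) => x /=.
by rewrite eqn_leq.
Qed.

Lemma pt_eqb X (eX : Enc X) (f g : X -> bool) :
  ptime f -> ptime g -> ptime (fun x => f x == g x).
Proof.
move=> pf pg; apply: (pt_ext (pt_negb (pt_addb pf pg))) => x.
by move=> /=; case: (f x); case: (g x).
Qed.

Lemma pt_minn X (eX : Enc X) (f g : X -> nat) :
  ptime f -> ptime g -> ptime (fun x => minn (f x) (g x)).
Proof. by move=> pf pg; apply: (pt_if (pt_ltn pf pg) pf pg). Qed.

Lemma size_bits_sumn s : size (nat_bits (sumn s)) <= esz s.
Proof.
elim: s => //= n s IH; apply: leq_trans (size_nat_bits_add _ _) _.
by rewrite esz_cons; have := esz_nat_ge n; lia.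
Qed.

Lemma pt_sumn X (eX : Enc X) (s : X -> seq nat) :
  ptime s -> ptime (fun x => sumn (s x)).
Proof.
move=> ps; have E z t : foldl addn z t = z + sumn t.
  by elim: t z => [|n t IH] z /=; rewrite ?addn0 // IH addnA.
apply: (@pt_ext _ _ _ _ (fun x => foldl addn 0 (s x))); last by move=> x /=; rewrite E.
have [q sz_s] := ptime_esz ps.
(* The partial sums are bounded globally: a sum has at most as many bits as its summands together,
   hence no more than the size of the code of the list. *)
apply: (pt_foldl (f := fun _ => addn)) (pt_const _ _ _) ps _.
  by apply: pt_addn; pt.
exists (pconst 4 * q + pconst 1)%R => e n; rewrite !pevE E add0n.
apply: leq_trans (esz_nat_le _) _; rewrite addn1 ltnS leq_mul2l /=.
apply: leq_trans (size_bits_sumn _) _.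
exact: leq_trans (esz_take _ _ _) (sz_s e).
Qed.

Lemma pt_size X A (eX : Enc X) (eA : Enc A) (s : X -> seq A) :
  ptime s -> ptime (fun x => size (s x)).
Proof.
move=> ps; apply: (@pt_ext _ _ _ _ (fun x => sumn [seq 1 | _ <- s x])).
  by apply: pt_sumn; apply: (pt_map (f := fun _ _ => 1)) ps; apply: pt_const.
by move=> x; elim: (s x) => //= a l ->.
Qed.

(** * The algorithm *)

Definition index_seq A (s : seq A) : seq (nat * A) := zip (iota 0 (size s)) s.

Lemma esz_nat_linear k : esz k <= 4 * k + 1.
Proof.
apply: leq_trans (esz_nat_le _) _; rewrite addn1 ltnS leq_mul2l /=.
by rewrite size_nat_bits_leq ltn_expl.
Qed.

Lemma esz_index_le A (eA : Enc A) k (t : seq A) (acc : seq (nat * A)) :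
  esz (catrev (zip (iota k (size t)) t) acc)
    <= esz acc + esz t + size t * (4 * (k + size t) + 3).
Proof.
elim: t k acc => [|a t IH] k acc /=; first by lia.
apply: leq_trans (IH _ _) _; rewrite !esz_cons esz_pair.
by have := esz_nat_linear k; lia.
Qed.

Lemma pt_index_seq X A (eX : Enc X) (eA : Enc A) (s : X -> seq A) :
  ptime s -> ptime (fun x => index_seq (s x)).
Proof.
move=> ps; pose step (z : nat * seq (nat * A)) a := (z.1 + 1, (z.1, a) :: z.2).
have foldE z t : foldl step z t
    = (z.1 + size t, catrev (zip (iota z.1 (size t)) t) z.2).
  elim: t z => [|a t IH] [k acc] /=; first by rewrite addn0.
  by rewrite IH /step /= addn1 addSnnS.
apply: (@pt_ext _ _ _ _ (fun x => rev (foldl step (0, [::]) (s x)).2)); last first.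
  by move=> x /=; rewrite foldE /= -/(rev _) revK.
have [q sz_s] := ptime_esz ps; apply: pt_rev; apply: pt_snd.
apply: (pt_foldl (f := fun _ => step) _ (pt_const _ _ _) ps).
  by rewrite /step; pt; apply: pt_addn; pt.
exists (pconst 4 * q + pconst 7 + q + q * (pconst 4 * q + pconst 3))%R => e n.
rewrite !pevE; set t := take n (s e).
have le_t : esz t <= pev q (esz e) by apply: leq_trans (esz_take _ _ _) (sz_s e).
have lt_t := size_esz eA t; rewrite foldE /= esz_pair add0n.
have le_k := esz_nat_linear (size t); have le_u := esz_index_le eA 0 t [::].
have le_sq : size t <= pev q (esz e) by apply: leq_trans (ltnW lt_t) le_t.
have le_mul : size t * (4 * (0 + size t) + 3) <= pev q (esz e) * (4 * pev q (esz e) + 3).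
  by rewrite add0n leq_mul // leq_add2r leq_mul2l le_sq.
have sz0 : esz ([::] : seq (nat * A)) = 1 by [].
rewrite sz0 in le_u.
set w := pev q (esz e) * _ in le_mul *; set z := size t * _ in le_u le_mul.
set y := esz (catrev _ _) in le_u *; set x := esz (size t) in le_k *.
clearbody w x y z; move: le_k le_u le_mul le_t le_sq; clear; lia.
Qed.

Lemma pt_iota X A (eX : Enc X) (eA : Enc A) (s : X -> seq A) :
  ptime s -> ptime (fun x => iota 0 (size (s x))).
Proof.
move=> ps; apply: (@pt_ext _ _ _ _ (fun x => [seq p.1 | p <- index_seq (s x)])).
  by apply: (pt_map (f := fun _ p => p.1)); [pt | apply: pt_index_seq].
by move=> x /=; rewrite -/(unzip1 _) unzip1_zip // size_iota.
Qed.

Lemma pt_nth X (eX : Enc X) (s : X -> seq nat) (i : X -> nat) :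
  ptime s -> ptime i -> ptime (fun x => nth 0 (s x) (i x)).
Proof.
(* At most one pair carries the index [i x], so the sum is the wanted entry; out of range it is
   empty and gives the default 0. *)
move=> ps pi; apply: (@pt_ext _ _ _ _
  (fun x => sumn [seq p.2 | p <- index_seq (s x) & p.1 == i x])).
  apply: pt_sumn; apply: (pt_map (f := fun _ p => p.2)); first by pt.
  apply: (pt_filter (b := fun x p => p.1 == i x)); last exact: pt_index_seq.
  apply: pt_eqn; first by pt.
  by apply: (pt_comp (f := fst)) pi; pt.
have small t k m : m < k -> sumn [seq p.2 | p <- zip (iota k (size t)) t & p.1 == m] = 0.
  elim: t k => //= a t IH k lt_mk; rewrite gtn_eqF //; apply: IH; exact: ltnW.
have E t k j :
    sumn [seq p.2 | p <- zip (iota k (size t)) t & p.1 == j + k] = nth 0 t j.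
  elim: t k j => [|a t IH] k j /=; first by rewrite nth_nil.
  case: j => [|j] /=; first by rewrite eqxx /= small ?addn0.
  by rewrite ltn_eqF ?addSn ?ltnS ?leq_addl // -addnS IH.
by move=> x; rewrite -(E (s x) 0) addn0.
Qed.

Definition pt_eq (T : eqType) (eT : Enc T) :=
  forall X (eX : Enc X) (f g : X -> T), ptime f -> ptime g -> ptime (fun x => f x == g x).

Lemma pt_eq_pair (T U : eqType) (eT : Enc T) (eU : Enc U) :
  pt_eq eT -> pt_eq eU -> @pt_eq (T * U)%type (enc_pair_inst eT eU).
Proof.
move=> pT pU X eX f g pf pg; apply: (@pt_ext _ _ _ _
  (fun x => ((f x).1 == (g x).1) && ((f x).2 == (g x).2))).
  by apply: pt_andb; [apply: pT | apply: pU]; pt.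
by [].
Qed.

Lemma pt_eq_nat2 : @pt_eq (nat * nat)%type _.
Proof. by apply: pt_eq_pair => X eX f g; apply: pt_eqn. Qed.

Lemma pt_eq_elt : @pt_eq (bool * nat)%type _.
Proof. by apply: pt_eq_pair => X eX f g; [apply: pt_eqb | apply: pt_eqn]. Qed.

Lemma pt_mem X (T : eqType) (eX : Enc X) (eT : Enc T) (f : X -> T) (s : X -> seq T) :
  pt_eq eT -> ptime f -> ptime s -> ptime (fun x => f x \in s x).
Proof.
move=> pe pf ps; apply: (@pt_ext _ _ _ _ (fun x => has (fun y => y == f x) (s x))).
  apply: (pt_has (b := fun x y => y == f x)) ps; apply: pe; first by pt.
  by apply: (pt_comp (f := fst)) pf; pt.
by move=> x /=; rewrite -has_pred1.
Qed.

Lemma uniq_count_le (T : eqType) (s : seq T) :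
  uniq s = all (fun x => count_mem x s <= 1) s.
Proof.
apply/idP/allP => [us x _|]; first by rewrite count_uniq_mem // leq_b1.
elim: s => //= x s IH H; rewrite IH ?andbT.
  rewrite -has_pred1 has_count -leqNgt.
  by have := H x (mem_head _ _); rewrite eqxx.
move=> y sy; have := H y; rewrite inE sy orbT => /(_ isT).
by apply: leq_trans; rewrite leq_addl.
Qed.

Lemma pt_uniq X (T : eqType) (eX : Enc X) (eT : Enc T) (s : X -> seq T) :
  pt_eq eT -> ptime s -> ptime (fun x => uniq (s x)).
Proof.
move=> pe ps; apply: (@pt_ext _ _ _ _
  (fun x => all (fun y => size [seq z <- s x | z == y] <= 1) (s x))).
  apply: (pt_all (b := fun x y => size [seq z <- s x | z == y] <= 1) _ ps).
  apply: pt_leq; last by pt.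
  apply: pt_size; apply: (pt_filter (b := fun p z => z == p.2)).
    by apply: pe; pt.
  by apply: (pt_comp (f := fst)) ps; pt.
move=> x /=; rewrite uniq_count_le; apply: eq_all => y.
by rewrite size_filter.
Qed.

Fixpoint words T (X : seq T) k : seq (seq T) :=
  if k is k'.+1 then [::] :: [seq x :: w | x <- X, w <- words X k'] else [:: [::]].

Lemma mem_words (T : eqType) (X : seq T) k w :
  (w \in words X k) = (size w <= k) && all (mem X) w.
Proof.
elim: k w => [|k IH] [|x w] //=.
rewrite inE /= ltnS; apply/allpairsP/and3P => [[[y v] /= [yX]]|[le_w xX wX]].
  by rewrite IH => /andP[le_v vX] [-> ->].
by exists (x, w); rewrite /= IH le_w.
Qed.

(** The length [k] is a constant of the program and not an input, so the induction builds one
    program per [k], with a polynomial that depends on [k]. *)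
Lemma pt_words X T (eX : Enc X) (eT : Enc T) (s : X -> seq T) k :
  ptime s -> ptime (fun x => words (s x) k).
Proof.
move=> ps; elim: k => [|k IH] /=; first exact: pt_const.
apply: pt_cons (pt_const _ _ _) _.
by apply: (pt_allpairs (f := fun _ x w => x :: w)) ps IH; pt.
Qed.

(* A node is a pair (side, index), sources being on side [true]; an instance
   is the pair of its supply and demand lists. *)
Notation node := (bool * nat)%type.
Notation instance := (seq nat * seq nat)%type.

Definition nodes (e : instance) : seq node :=
  [seq (true, i) | i <- iota 0 (size e.1)] ++ [seq (false, j) | j <- iota 0 (size e.2)].

Definition value (e : instance) (v : node) : nat :=
  nth 0 (if v.1 then e.1 else e.2) v.2.

Definition side_sum e (b : bool) (s : seq node) := sumn [seq value e v | v <- s & v.1 == b].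

Definition block_ok e (s : seq node) :=
  [&& 0 < size s, uniq s & side_sum e true s == side_sum e false s].

(** Each block is listed in every order of its nodes, so a block obtained from elsewhere belongs to
    the list however it is enumerated. *)
Definition small_blocks e := [seq s <- words (nodes e) 5 | block_ok e s].

Definition moves C e := [seq Q <- words (small_blocks e) C | uniq (flatten Q)].

Definition gain (P : seq (seq node)) := sumn [seq 7 - size s | s <- P].

Definition hit (Q : seq (seq node)) (s : seq node) := has (fun v => v \in flatten Q) s.

Definition swap (P Q : seq (seq node)) := Q ++ [seq s <- P | ~~ hit Q s].

Definition improve (P Q : seq (seq node)) :=
  if gain P < gain (swap P Q) then swap P Q else P.

Definition pass C e P := foldl improve P (moves C e).

(* Each useful pass raises the gain, which is at most 6 times the number of
   nodes, so one pass for each of these ticks reaches a fixed point. *)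
Definition ticks e :=
  (true, 0) :: nodes e ++ nodes e ++ nodes e ++ nodes e ++ nodes e ++ nodes e.

Definition local_search C e := foldl (fun P _ => pass C e P) [::] (ticks e).

Definition grid (s : seq node) : seq (nat * nat) :=
  [seq (i, j) | i <- [seq v.2 | v <- s & v.1], j <- [seq v.2 | v <- s & ~~ v.1]].

(* The cells of a block come first and exhaust all its nodes; the cells of the
   whole instance then complete the plan. *)
Definition cells e P := flatten [seq grid s | s <- P] ++ grid (nodes e).

Notation log := (seq ((nat * nat) * nat)).

Definition row_sum (l : log) i := sumn [seq t.2 | t <- l & t.1.1 == i].
Definition col_sum (l : log) j := sumn [seq t.2 | t <- l & t.1.2 == j].
(** A sum, because a cell visited within a block is visited again in the final sweep and occurs
    twice in the log. *)
Definition entry (l : log) i j := sumn [seq t.2 | t <- l & t.1 == (i, j)].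

Definition fill (e : instance) (l : log) c : log :=
  (c, minn (nth 0 e.1 c.1 - row_sum l c.1) (nth 0 e.2 c.2 - col_sum l c.2)) :: l.

Definition greedy e P := foldl (fill e) [::] (cells e P).

Definition plan C e :=
  [seq [seq entry (greedy e (local_search C e)) i j | j <- iota 0 (size e.2)]
     | i <- iota 0 (size e.1)].

(** * Running time of the algorithm *)

Lemma pt_of X A B (eX : Enc X) (eA : Enc A) (eB : Enc B) (h : A -> B) (f : X -> A) :
  ptime h -> ptime f -> ptime (fun x => h (f x)).
Proof. by move=> ph pf; apply: pt_comp pf ph. Qed.

Ltac pt2 :=
  lazymatch goal with
  | |- @ptime _ _ _ _ (fun x => _ + _) => apply: pt_addn
  | |- @ptime _ _ _ _ (fun x => _ - _) => apply: pt_subn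
  | |- @ptime _ _ _ _ (fun x => minn _ _) => apply: pt_minn
  | |- @ptime _ _ _ _ (fun x => _ < _) => apply: pt_ltn
  | |- @ptime _ _ _ _ (fun x => _ == _) =>
      first [apply: pt_eqn | apply: pt_eqb | apply: pt_eq_nat2 | apply: pt_eq_elt]
  | |- @ptime _ _ _ _ (fun x => sumn _) => apply: pt_sumn
  | |- @ptime _ _ _ _ (fun x => nth 0 _ _) => apply: pt_nth
  | |- @ptime _ _ _ _ (fun x => iota 0 (size _)) => apply: pt_iota
  | |- @ptime _ _ _ _ (fun x => size _) => apply: pt_size
  | |- @ptime _ _ _ _ (fun x => _ ++ _) => apply: pt_cat
  | |- @ptime _ _ _ _ (fun x => flatten [seq _ | _ <- _, _ <- _]) => apply: pt_allpairs
  | |- @ptime _ _ _ _ (fun x => flatten _) => apply: pt_flatten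
  | |- @ptime _ _ _ _ (fun x => [seq _ <- _ | _]) => apply: pt_filter
  | |- @ptime _ _ _ _ (fun x => map _ _) => apply: pt_map
  | |- @ptime _ _ _ _ (fun x => has _ _) => apply: pt_has
  | |- @ptime _ _ _ _ (fun x => words _ _) => apply: pt_words
  end.

Ltac pt_hyp :=
  match goal with
  | H : @ptime _ _ _ _ ?h |- @ptime _ _ _ _ (fun x => ?h _) => apply: (pt_of H)
  end.

Ltac pts := cbn beta; repeat (first [assumption | pt2 | pt_hyp | pt1]; cbn beta).

Lemma pt_nodes X (eX : Enc X) (e : X -> instance) :
  ptime e -> ptime (fun x => nodes (e x)).
Proof. by move=> pe; rewrite /nodes; pts. Qed.

Lemma pt_value X (eX : Enc X) (e : X -> instance) (v : X -> node) :
  ptime e -> ptime v -> ptime (fun x => value (e x) (v x)).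
Proof. by move=> pe pv; rewrite /value; pts. Qed.

Lemma pt_side_sum X (eX : Enc X) (e : X -> instance) (b : bool) (s : X -> seq node) :
  ptime e -> ptime s -> ptime (fun x => side_sum (e x) b (s x)).
Proof. by move=> pe ps; rewrite /side_sum; pts; apply: pt_value; pts. Qed.

Lemma pt_block_ok X (eX : Enc X) (e : X -> instance) (s : X -> seq node) :
  ptime e -> ptime s -> ptime (fun x => block_ok (e x) (s x)).
Proof.
move=> pe ps; rewrite /block_ok; pts; try exact: pt_side_sum.
by apply: pt_uniq => //; apply: pt_eq_elt.
Qed.

Lemma pt_moves X (eX : Enc X) C (e : X -> instance) :
  ptime e -> ptime (fun x => moves C (e x)).
Proof.
move=> pe; rewrite /moves; pts; last first.
  rewrite /small_blocks; pts; last exact: pt_nodes.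
  by apply: pt_block_ok; pts.
by apply: pt_uniq; [apply: pt_eq_elt | pts].
Qed.

Lemma pt_gain X (eX : Enc X) (P : X -> seq (seq node)) :
  ptime P -> ptime (fun x => gain (P x)).
Proof. by move=> pP; rewrite /gain; pts. Qed.

Lemma pt_swap X (eX : Enc X) (P Q : X -> seq (seq node)) :
  ptime P -> ptime Q -> ptime (fun x => swap (P x) (Q x)).
Proof.
move=> pP pQ; rewrite /swap /hit; pts.
by apply: pt_mem; [apply: pt_eq_elt | pts | pts].
Qed.

Lemma pt_improve X (eX : Enc X) (P Q : X -> seq (seq node)) :
  ptime P -> ptime Q -> ptime (fun x => improve (P x) (Q x)).
Proof.
by move=> pP pQ; rewrite /improve; pts; try apply: pt_gain; try apply: pt_swap; pts.
Qed.

Lemma esz_filter A (eA : Enc A) p (s : seq A) : esz [seq x <- s | p x] <= esz s.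
Proof.
elim: s => //= a s IH; case: (p a); rewrite !esz_cons ?ltnS ?leq_add2l //.
exact: leq_trans IH (leqW (leq_addl _ _)).
Qed.

Lemma esz_improve (P Q : seq (seq node)) : esz (improve P Q) <= esz P + esz Q.
Proof.
rewrite /improve; case: ifP => _; last exact: leq_addr.
apply: leq_trans (leqnSn _) _; rewrite esz_cat addnC leq_add2r.
exact: esz_filter.
Qed.

Lemma esz_pass C e P : esz (pass C e P) <= esz P + esz (moves C e).
Proof.
rewrite /pass; elim: (moves C e) P => [|Q M IH] P /=; first exact: leq_addr.
apply: leq_trans (IH _) _; rewrite esz_cons.
apply: leq_trans (leq_add (esz_improve P Q) (leqnn _)) _.
by rewrite -addnA leq_add2l leqnSn.
Qed.

Lemma pt_pass X (eX : Enc X) C (e : X -> instance) (P : X -> seq (seq node)) :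
  ptime e -> ptime P -> ptime (fun x => pass C (e x) (P x)).
Proof.
move=> pe pP; rewrite /pass; apply: (pt_foldl_add (f := fun _ => improve)) => //.
- by apply: pt_improve; pts.
- exact: pt_moves.
exists 'X%R => x b a; rewrite pevX; apply: leq_trans (esz_improve _ _) _.
by rewrite leq_add2l leq_addl.
Qed.

Lemma pt_local_search X (eX : Enc X) C (e : X -> instance) :
  ptime e -> ptime (fun x => local_search C (e x)).
Proof.
move=> pe; rewrite /local_search.
apply: (pt_foldl_add (f := fun x P _ => pass C (e x) P) _ (pt_const _ _ _)).
- by apply: pt_pass; pts.
- by rewrite /ticks; pts; apply: pt_nodes.
have [q sz_m] := ptime_esz (pt_moves C pe).
exists q => x b a; apply: leq_trans (esz_pass _ _ _) _; rewrite leq_add2l.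
by apply: leq_trans (sz_m x) _; rewrite pev_mono // leq_addr.
Qed.

Lemma pt_grid X (eX : Enc X) (s : X -> seq node) :
  ptime s -> ptime (fun x => grid (s x)).
Proof. by move=> ps; rewrite /grid; pts. Qed.

Lemma pt_fill X (eX : Enc X) (e : X -> instance) (l : X -> log) (c : X -> nat * nat) :
  ptime e -> ptime l -> ptime c -> ptime (fun x => fill (e x) (l x) (c x)).
Proof. by move=> pe pl pc; rewrite /fill /row_sum /col_sum; pts. Qed.

Lemma pt_greedy X (eX : Enc X) (e : X -> instance) (P : X -> seq (seq node)) :
  ptime e -> ptime P -> ptime (fun x => greedy (e x) (P x)).
Proof.
move=> pe pP; rewrite /greedy /cells.
apply: (pt_foldl_add (f := fun x => fill (e x)) _ (pt_const _ _ _)).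
- by apply: pt_fill; pts.
- by pts; apply: pt_grid; pts; apply: pt_nodes.
(* An amount never exceeds the supply of its row, so its code is bounded through that supply,
   independently of the log. *)
have pn : ptime (fun p : X * nat => nth 0 (e p.1).1 p.2) by pts.
have [q sz_n] := ptime_esz pn.
exists ('X + pconst 2 * (q \Po ('X + pconst 1)) + pconst 2)%R => x b [i j].
rewrite /fill esz_cons esz_pair !pevE.
set d := minn _ _; have le_d : d <= nth 0 (e x).1 i.
  by rewrite /d geq_min leq_subLR leq_addl.
have := esz_nat_mono le_d; have := sz_n (x, i); rewrite /= esz_pair => le_q.
have : pev q (esz x + esz i).+1 <= pev q (esz x + esz (i, j) + 1).
  by rewrite addn1 pev_mono // ltnS leq_add2l esz_pair ltnW // ltnS leq_addr.
by lia.
Qed.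

Lemma pt_plan X (eX : Enc X) C (e : X -> instance) :
  ptime e -> ptime (fun x => plan C (e x)).
Proof.
move=> pe; rewrite /plan /entry; pts.
by apply: pt_greedy; pts; apply: pt_local_search; pts.
Qed.

(** * The greedy plan *)

Definition node_of (c : nat * nat) (b : bool) : node := (b, if b then c.1 else c.2).

Definition used (l : log) (v : node) := \sum_(t <- l | node_of t.1 v.1 == v) t.2.

Definition residual e l v := value e v - used l v.

Definition live e l s := count (fun v => 0 < residual e l v) s.

Definition positives (l : log) := count (fun t => 0 < t.2) l.

Definition side_rem e l b s := \sum_(v <- s | v.1 == b) residual e l v.

Lemma used_row l i : used l (true, i) = row_sum l i.
Proof.
rewrite /row_sum sumnE big_map big_filter.
by apply: eq_bigl => t; rewrite xpair_eqE.
Qed.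

Lemma used_col l j : used l (false, j) = col_sum l j.
Proof.
rewrite /col_sum sumnE big_map big_filter.
by apply: eq_bigl => t; rewrite xpair_eqE.
Qed.

Definition fill_amount e l c :=
  minn (residual e l (node_of c true)) (residual e l (node_of c false)).

Lemma fillE e l c : fill e l c = (c, fill_amount e l c) :: l.
Proof. by rewrite /fill /fill_amount /residual used_row used_col. Qed.

Lemma used_fill e l c v :
  used (fill e l c) v = (if node_of c v.1 == v then fill_amount e l c else 0) + used l v.
Proof. by rewrite fillE /used big_cons /=; case: ifP. Qed.

Lemma fill_amount_le e l c b : fill_amount e l c <= residual e l (node_of c b).
Proof. by rewrite /fill_amount geq_min; case: b; rewrite leqnn ?orbT. Qed.

Lemma residual_fill e l c v :
  residual e (fill e l c) v =
  residual e l v - (if node_of c v.1 == v then fill_amount e l c else 0).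
Proof. by rewrite /residual used_fill addnC subnDA. Qed.

Lemma used_fill_le e l c : (forall v, used l v <= value e v) ->
  forall v, used (fill e l c) v <= value e v.
Proof.
move=> le_uv v; rewrite used_fill; case: eqP => [E|_]; last by rewrite add0n.
by have := fill_amount_le e l c v.1; rewrite E /residual; have := le_uv v; lia.
Qed.

Lemma foldl_fill_used_le e l cs : (forall v, used l v <= value e v) ->
  forall v, used (foldl (fill e) l cs) v <= value e v.
Proof. by elim: cs l => //= c cs IH l le_uv; apply: IH; apply: used_fill_le. Qed.

Lemma residual_foldl_le e l cs v : residual e (foldl (fill e) l cs) v <= residual e l v.
Proof.
elim: cs l => //= c cs IH l; apply: leq_trans (IH _) _.
by rewrite residual_fill leq_subr.
Qed.

Lemma live_foldl_le e l cs s : live e (foldl (fill e) l cs) s <= live e l s.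
Proof. by apply: sub_count => v /leq_trans; apply; apply: residual_foldl_le. Qed.

Lemma side_rem_fill e l c b s : uniq s -> node_of c b \in s ->
  side_rem e (fill e l c) b s + fill_amount e l c = side_rem e l b s.
Proof.
move=> us cs; rewrite /side_rem.
rewrite (big_rem _ cs) [RHS](big_rem _ cs) /= eqxx.
rewrite residual_fill eqxx /= addnAC subnK ?fill_amount_le //; congr (_ + _).
rewrite big_seq_cond [RHS]big_seq_cond; apply: eq_bigr => v.
rewrite mem_rem_uniq // => /andP[/andP[/= vc _] /eqP vb].
by rewrite residual_fill vb eq_sym (negbTE vc) subn0.
Qed.

Definition balanced_on e l s := side_rem e l true s = side_rem e l false s.

Lemma balanced_fill e l c s : uniq s -> (forall b, node_of c b \in s) ->
  balanced_on e l s -> balanced_on e (fill e l c) s.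
Proof.
move=> us cs bal; apply: (@addIn (fill_amount e l c)).
by rewrite !side_rem_fill.
Qed.

Lemma fill_dead e l c : exists b, residual e (fill e l c) (node_of c b) = 0.
Proof.
have [le_r|lt_r] := leqP (residual e l (node_of c true)) (residual e l (node_of c false)).
  by exists true; rewrite residual_fill eqxx /fill_amount (minn_idPl le_r) subnn.
by exists false; rewrite residual_fill eqxx /fill_amount (minn_idPr (ltnW lt_r)) subnn.
Qed.

(* A step of positive amount kills an endpoint, and if nothing survives it kills
   two: this is why the potential is the predecessor of the number of live nodes. *)
Lemma live_fill e l c s : uniq s -> (forall b, node_of c b \in s) ->
  positives (fill e l c) + (live e (fill e l c) s).-1
    <= positives l + (live e l s).-1.
Proof.
move=> us cs; have le_live := live_foldl_le e l [:: c] s.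
rewrite /= in le_live.
have -> : positives (fill e l c) = (0 < fill_amount e l c) + positives l by rewrite fillE.
have [_|amt_gt0] := posnP (fill_amount e l c).
  by rewrite leq_add2l; move: le_live; clear; lia.
have [b dead] := fill_dead e l c.
have alive b' : 0 < residual e l (node_of c b').
  exact: leq_trans amt_gt0 (fill_amount_le _ _ _ _).
have lt_live : live e (fill e l c) s < live e l s.
  have /permP ps := perm_to_rem (cs b).
  rewrite /live !ps /= alive dead ltnn add0n add1n ltnS.
  apply: sub_count => v /leq_trans; apply.
  by rewrite residual_fill leq_subr.
have two : 1 < live e l s.
  rewrite /live -size_filter.
  have u2 : uniq [:: node_of c true; node_of c false] by [].
  apply: (uniq_leq_size u2) => v; rewrite !inE mem_filter => /orP[]/eqP->;
    by rewrite alive cs.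
lia.
Qed.

Lemma foldl_fill_inv e l cs s : uniq s ->
    {in cs, forall c b, node_of c b \in s} -> balanced_on e l s ->
  balanced_on e (foldl (fill e) l cs) s /\
  positives (foldl (fill e) l cs) + (live e (foldl (fill e) l cs) s).-1
    <= positives l + (live e l s).-1.
Proof.
move=> us; elim: cs l => //= c cs IH l cs_s bal.
have c_s b : node_of c b \in s by apply: cs_s; rewrite mem_head.
have [|bal' le_pos] := IH (fill e l c) _ (balanced_fill us c_s bal).
  by move=> c' c'_cs; apply: cs_s; rewrite inE c'_cs orbT.
by split=> //; apply: leq_trans le_pos (live_fill _ _ _ _).
Qed.

Lemma foldl_fill_dead e l cs c : c \in cs ->
  exists b, residual e (foldl (fill e) l cs) (node_of c b) = 0.
Proof.
elim: cs l => //= c' cs IH l; rewrite inE => /orP[/eqP<-|]; last exact: IH.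
have [b dead] := fill_dead e l c.
by exists b; apply/eqP; rewrite -leqn0 -dead residual_foldl_le.
Qed.

Lemma foldl_fill_out e l cs (s : seq node) v : {in cs, forall c b, node_of c b \in s} ->
  v \notin s -> residual e (foldl (fill e) l cs) v = residual e l v.
Proof.
elim: cs l => //= c cs IH l cs_s vs; rewrite IH //; last first.
  by move=> c' c'_cs; apply: cs_s; rewrite inE c'_cs orbT.
rewrite residual_fill; case: eqP => [E|_]; last by rewrite subn0.
by rewrite -E cs_s ?mem_head in vs.
Qed.

Lemma mem_grid s c : (c \in grid s) = (node_of c true \in s) && (node_of c false \in s).
Proof.
case: c => i j; apply/allpairsP/andP => [[[i' j'] /= []]|[si sj]].
  move=> /mapP[[[] ?]]; rewrite mem_filter //= => si ->.
  move=> /mapP[[[] ?]]; rewrite mem_filter //= => sj -> [-> ->].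
  by rewrite /node_of /= si sj.
exists (i, j); split=> //=; apply/mapP.
  by exists (true, i); rewrite ?mem_filter.
by exists (false, j); rewrite ?mem_filter.
Qed.

(** If a node of [s] had something left, each cell joining it to the other side would have its dead
    end there. The whole other side would be exhausted, and by balance so would be the side of that
    node. *)
Lemma grid_dead e l s : balanced_on e l s ->
    {in grid s, forall c, exists b, residual e l (node_of c b) = 0} ->
  {in s, forall v, residual e l v = 0}.
Proof.
move=> bal dead [b i] sv; apply/eqP; rewrite -leqn0 leqNgt; apply/negP => rv.
have side0 : side_rem e l (~~ b) s = 0.
  rewrite /side_rem big_seq_cond big1 // => -[b' j] /andP[sw /eqP/= Eb].
  pose c := if b then (i, j) else (j, i).
  have cs : c \in grid s.
    by rewrite mem_grid /c; case: b Eb sv sw {rv c} => /= -> -> ->.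
  have [b2] := dead _ cs; rewrite /c; case: b Eb rv {sv c cs} => /= ->;
    case: b2; rewrite /node_of /= => // rv E; by rewrite E in rv.
have : side_rem e l b s = 0 by move: bal side0; rewrite /balanced_on; case: (b) => /= -> ->.
move/eqP; rewrite /side_rem sum_nat_seq_eq0 => /allP/(_ _ sv).
by rewrite /= eqxx /= -leqn0 leqNgt rv.
Qed.

(** Serves twice: for a block, where the predecessor is the one cell that the block saves, and for
    the set of all nodes, where only the nodes outside the packing are still live. *)
Lemma grid_phase e l s : uniq s -> balanced_on e l s ->
  let l' := foldl (fill e) l (grid s) in
  {in s, forall v, residual e l' v = 0} /\ positives l' <= positives l + (live e l s).-1.
Proof.
move=> us bal l'; have cs_s : {in grid s, forall c b, node_of c b \in s}.
  by move=> c; rewrite mem_grid => /andP[c1 c2] [].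
have [bal' le_pos] := foldl_fill_inv us cs_s bal.
split; last exact: leq_trans (leq_addr _ _) le_pos.
by apply: grid_dead bal' _ => c; apply: foldl_fill_dead.
Qed.

(** * Packings and the cost of the greedy plan *)

Lemma uniq_nodes e : uniq (nodes e).
Proof.
rewrite cat_uniq !map_inj_uniq ?iota_uniq ?andbT /=; try by move=> ? ? [].
by apply/hasPn => v /mapP[i _ ->]; apply/negP => /mapP[j _].
Qed.

Lemma size_nodes e : size (nodes e) = size e.1 + size e.2.
Proof. by rewrite size_cat !size_map !size_iota. Qed.

Lemma mem_nodes e v : (v \in nodes e) = (v.2 < size (if v.1 then e.1 else e.2)).
Proof.
case: v => b i; rewrite mem_cat; apply/orP/idP => /= [|lt_i].
  by case=> /mapP[j]; rewrite mem_iota add0n => lt_j [-> ->].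
by case: b lt_i => lt_i; [left|right]; apply/mapP; exists i; rewrite ?mem_iota.
Qed.

Lemma side_rem_nil e b s : side_rem e [::] b s = side_sum e b s.
Proof.
rewrite /side_sum sumnE big_map big_filter; apply: eq_bigr => v _.
by rewrite /residual /used big_nil subn0.
Qed.

Lemma side_sum_nodes e b : side_sum e b (nodes e) = sumn (if b then e.1 else e.2).
Proof.
rewrite /side_sum sumnE big_map big_filter big_cat !big_map /=.
have Z (s : seq nat) : \sum_(i <- iota 0 (size s)) nth 0 s i = sumn s.
  by rewrite sumnE [RHS](big_nth 0) /index_iota subn0.
by case: b; rewrite /= ?big_pred0_eq /value /= ?addn0 ?add0n Z.
Qed.

Record packing e (P : seq (seq node)) : Prop := Packing {
  packing_ok : all (block_ok e) P;
  packing_uniq : uniq (flatten P);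
  packing_sub : {subset flatten P <= nodes e} }.

Lemma blocks_phase e P : all (block_ok e) P -> uniq (flatten P) ->
  let l := foldl (fill e) [::] (flatten [seq grid s | s <- P]) in
  [/\ {in flatten P, forall v, residual e l v = 0},
      forall v, v \notin flatten P -> residual e l v = value e v
    & positives l + size P <= size (flatten P)].
Proof.
elim/last_ind: P => [|P s IH] /=.
  by move=> _ _; split=> // v _; rewrite /residual /used big_nil subn0.
rewrite all_rcons map_rcons -!cats1 !flatten_cat /= !cats0 cat_uniq foldl_cat.
move=> /andP[/and3P[s_gt0 us /eqP bal] okP] /and3P[uP /hasPn Ps _].
have [dead out le_pos] := IH okP uP; set l := foldl _ _ _ in dead out le_pos *.
(* The earlier blocks are disjoint from [s] and have left its nodes untouched, so its initial
   balance still holds. *)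
have bal_l : balanced_on e l s.
  have E b : side_rem e l b s = side_sum e b s.
    rewrite -side_rem_nil /side_rem big_seq_cond [RHS]big_seq_cond.
    apply: eq_bigr => v /andP[vs _]; rewrite out ?Ps //.
    by rewrite /residual /used big_nil subn0.
  by rewrite /balanced_on !E.
have [dead' le_pos'] := grid_phase us bal_l.
split=> [v|v|].
- rewrite mem_cat => /orP[vP|]; last exact: dead'.
  by apply/eqP; rewrite -leqn0 -(dead v vP) residual_foldl_le.
- rewrite mem_cat negb_or => /andP[vP vs].
  rewrite (@foldl_fill_out _ _ _ s) ?out // => c.
  by rewrite mem_grid => /andP[c1 c2] [].
have : live e l s <= size s := count_size _ _.
by rewrite !size_cat /=; move: le_pos le_pos' s_gt0; lia.
Qed.

Lemma mem_foldl_fill e l cs t :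
  t \in foldl (fill e) l cs -> t \in l \/ t.1 \in cs.
Proof.
elim: cs l => [|c cs IH] l /=; first by left.
move=> /IH[|t_cs]; last by right; rewrite inE t_cs orbT.
by rewrite !inE => /orP[/eqP->|]; [right; rewrite eqxx | left].
Qed.

Lemma greedyP e P : packing e P -> sumn e.1 = sumn e.2 ->
  let l := greedy e P in
  [/\ forall v, used l v = value e v,
      forall t, t \in l -> t.1.1 < size e.1 /\ t.1.2 < size e.2
    & positives l + size P <= size (nodes e)].
Proof.
move=> [okP uP subP] bal l.
have in_nodes : {in cells e P, forall c b, node_of c b \in nodes e}.
  move=> c; rewrite mem_cat => /orP[/flattenP[g /mapP[s sP ->]]|].
    rewrite mem_grid => /andP[c1 c2] b; apply: subP; apply/flattenP.
    by exists s => //; case: b.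
  by rewrite mem_grid => /andP[c1 c2] [].
have un := uniq_nodes e.
have bal0 : balanced_on e [::] (nodes e).
  by rewrite /balanced_on !side_rem_nil !side_sum_nodes.
pose l0 := foldl (fill e) [::] (flatten [seq grid s | s <- P]).
have def_l : l = foldl (fill e) l0 (grid (nodes e)) by rewrite -foldl_cat.
have [dead0 out0 le_pos0] := blocks_phase okP uP.
rewrite -/l0 in dead0 out0 le_pos0.
have bal1 : balanced_on e l0 (nodes e).
  apply: (foldl_fill_inv un _ bal0).1 => c cP; apply: in_nodes.
  by rewrite mem_cat cP.
have [dead le_pos] := grid_phase un bal1; rewrite -def_l in dead le_pos.
have le_used : forall v, used l v <= value e v.
  by apply: foldl_fill_used_le => v; rewrite /used big_nil.
split=> [v|t|].
- have [vn|vn] := boolP (v \in nodes e).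
    apply/eqP; rewrite eqn_leq le_used /= -subn_eq0; exact/eqP/dead.
  (* Outside the instance the value is the default 0. *)
  apply/eqP; rewrite eqn_leq le_used /= /value nth_default //.
  by rewrite mem_nodes -leqNgt in vn.
- move=> /mem_foldl_fill[//|] /in_nodes t_nodes.
  by have := t_nodes true; have := t_nodes false; rewrite !mem_nodes.
(* Nodes of the packing are already exhausted when the final sweep starts. *)
have le_live : live e l0 (nodes e) + size (flatten P) <= size (nodes e).
  rewrite -(count_predC (mem (flatten P)) (nodes e)) addnC.
  have -> : size (flatten P) = count (mem (flatten P)) (nodes e).
    rewrite -size_filter; apply: perm_size; apply: uniq_perm => //.
      exact: filter_uniq.
    move=> v; rewrite mem_filter /=; apply/idP/andP => [vP|[]//].
    by split=> //; apply: subP.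
  rewrite leq_add2l; apply: sub_count => v /=; apply: contraL => vP.
  by rewrite dead0.
by move: le_pos le_pos0 le_live; clear; lia.
Qed.

Lemma greedy_entry_row (e : instance) (l : log) i :
  (forall t : nat * nat * nat, t \in l -> t.1.2 < size e.2) ->
  \sum_(j < size e.2) entry l i j = used l (true, i).
Proof.
move=> l_lt; under eq_bigr => j _ do rewrite /entry sumnE big_map big_filter.
rewrite (exchange_big_dep (fun t : nat * nat * nat => t.1.1 == i)) /=; last first.
  by move=> j [[i' j'] d] _ /eqP[->].
rewrite /used big_seq_cond [RHS]big_seq_cond; apply: eq_big => [t|].
  by rewrite xpair_eqE.
move=> [[i' j'] d] /andP[/l_lt /= lt_j' /eqP/= ->].
rewrite (big_pred1 (Ordinal lt_j')) // => j.
by rewrite xpair_eqE eqxx /= -val_eqE eq_sym.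
Qed.

Lemma greedy_entry_col (e : instance) (l : log) j :
  (forall t : nat * nat * nat, t \in l -> t.1.1 < size e.1) ->
  \sum_(i < size e.1) entry l i j = used l (false, j).
Proof.
move=> l_lt; under eq_bigr => i _ do rewrite /entry sumnE big_map big_filter.
rewrite (exchange_big_dep (fun t : nat * nat * nat => t.1.2 == j)) /=; last first.
  by move=> i [[i' j'] d] _ /eqP[_ ->].
rewrite /used big_seq_cond [RHS]big_seq_cond; apply: eq_big => [t|].
  by rewrite xpair_eqE.
move=> [[i' j'] d] /andP[/l_lt /= lt_i' /eqP/= ->].
rewrite (big_pred1 (Ordinal lt_i')) // => i.
by rewrite xpair_eqE eqxx andbT /= -val_eqE eq_sym.
Qed.

(** A positive entry has a positive increment at its own cell, and different cells have different
    increments. *)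
Lemma card_entry_gt0 l n m :
  #|[set ij : 'I_n * 'I_m | 0 < entry l ij.1 ij.2]| <= positives l.
Proof.
rewrite /positives -size_filter -(size_map fst).
set s := map _ _.
rewrite cardE -(size_map (fun ij : 'I_n * 'I_m => (ij.1 : nat, ij.2 : nat))).
apply: uniq_leq_size.
  rewrite map_inj_uniq ?enum_uniq // => -[i j] [i' j'] [] /val_inj -> /val_inj ->.
  by [].
move=> c /mapP[[i j]]; rewrite mem_enum inE /= => pos ->.
move: pos; rewrite lt0n /entry sumnE big_map big_filter sum_nat_seq_neq0.
move=> /hasP[t tl /andP[/eqP t1 t2]]; apply/mapP; exists t => //.
by rewrite mem_filter lt0n t2.
Qed.

(** * Locally optimal packings *)

(** Bounds the blocks inserted in a tree of depth [k]: an inserted block meets at most five blocks,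
    each of which meets at most five others. *)
Fixpoint tree_bound k := if k is k'.+1 then 1 + 5 * (5 * tree_bound k') else 0.

(** Summation by level sets; it converts multiplicities into sums over genuine sets. *)
Lemma layer_cake (T : finType) (c f : T -> nat) M : (forall x, c x <= M) ->
  \sum_x c x * f x = \sum_(t < M) \sum_(x | t < c x) f x.
Proof.
move=> le_c; rewrite (exchange_big_dep xpredT) //=; apply: eq_bigr => x _.
rewrite -(big_ord_widen _ (fun=> f x) (le_c x)) sum_nat_const card_ord //.
Qed.

(* 12 times a lower bound of (d + a - 2) / a over the sizes a with d <= 7 - a. *)
Definition charge d := nth 0 [:: 0; 6; 12; 15; 20; 30] d.

(** A finite check. [M] stands for the largest slack around a block of size [b] and [l] for the
    other slacks. The inequality is tight, for instance at [b = 3], [M = 2], [l = [:: 2; 2]] and at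
    [b = 4], [M = 1], [l = [:: 1; 1; 1]]. *)
Lemma charge_num b M l : 2 <= b <= 5 -> M <= 5 -> size l < b -> all (leq^~ M) l ->
  12 * (6 - b) <= 12 * (7 - b - sumn l) + sumn (map charge l) + charge M.
Proof.
move=> /andP[b2 b5] M5 lt_l le_l.
have chk : all (fun b => all (fun M => all (fun l =>
    (size l < b) && all (leq^~ M) l ==>
    (12 * (6 - b) <= 12 * (7 - b - sumn l) + sumn (map charge l) + charge M))
  (words (iota 0 6) 4)) (iota 0 6)) (iota 2 4) by vm_compute.
have b_in : b \in iota 2 4 by rewrite mem_iota b2 ltnS.
have M_in : M \in iota 0 6 by rewrite mem_iota ltnS.
have l_in : l \in words (iota 0 6) 4.
  rewrite mem_words -ltnS (leq_trans lt_l b5) /=.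
  apply/allP => x /(allP le_l) le_x; change (x \in iota 0 6).
  by rewrite mem_iota ltnS (leq_trans le_x).
have := allP (allP (allP chk _ b_in) _ M_in) _ l_in.
by rewrite lt_l le_l.
Qed.

Section LocalOptimum.

Variables (TA TB : finType) (adj : TB -> TA -> bool) (sa : TA -> nat) (sb : TB -> nat).
Variable K : nat.

Hypothesis sa_bounds : forall A, 2 <= sa A <= 5.
Hypothesis sb_bounds : forall B, 2 <= sb B <= 5.
Hypothesis degA : forall A, #|[pred B | adj B A]| <= sa A.
Hypothesis degB : forall B, #|[pred A | adj B A]| <= sb B.

Let f B := 7 - sb B.
Let g A := 7 - sa A.

Hypothesis local_opt : forall S : {set TB}, #|S| <= 5 * tree_bound K ->
  \sum_(B in S) f B <= \sum_(A | [exists B in S, adj B A]) g A.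

(* Message passing on the intersection graph: [msg k B A] is the surplus that B
   can bring to A when the depth-k tree hanging below B (away from A) is
   exchanged as well. *)
Fixpoint msg k B A : nat :=
  if k is k'.+1 then
    f B - \sum_(A' | adj B A' && (A' != A))
            (g A' - \sum_(B' | adj B' A' && (B' != B)) msg k' B' A')
  else 0.

Definition total k A := \sum_(B | adj B A) msg k B A.

(* Multiplicities of the vertices of the graph in the exchange tree, which is
   unfolded: a vertex reached along several walks is counted for each of them. *)
Fixpoint cntB k B A X : nat :=
  if k is k'.+1 then
    if msg k B A == 0 then 0 else
    (X == B) + \sum_(A' | adj B A' && (A' != A))
      \sum_(B' | adj B' A' && (B' != B)) cntB k' B' A' X
  else 0.

Fixpoint cntA k B A Y : nat :=
  if k is k'.+1 then
    if msg k B A == 0 then 0 else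
    \sum_(A' | adj B A' && (A' != A))
      ((Y == A') + \sum_(B' | adj B' A' && (B' != B)) cntA k' B' A' Y)
  else 0.

Lemma partial_total k A B :
  \sum_(B' | adj B' A && (B' != B)) msg k B' A <= total k A.
Proof.
rewrite /total [leqRHS](bigID (fun B' => B' != B)) /=; exact: leq_addr.
Qed.

Lemma total_split k A B : adj B A ->
  total k A = msg k B A + \sum_(B' | adj B' A && (B' != B)) msg k B' A.
Proof. by move=> adjBA; rewrite /total (bigD1 B). Qed.

Lemma sum_indicator (T : finType) (x : T) (F : T -> nat) :
  \sum_y (y == x) * F y = F x.
Proof.
rewrite (bigD1 x) //= eqxx mul1n big1 ?addn0 // => y /negbTE ->.
by rewrite mul0n.
Qed.

(** No truncation in [msg] loses anything: the outer subtraction is exact whenever B is really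
    inserted, and otherwise the counts vanish; the inner ones are exact by the bound on [total] at
    smaller depths. So [msg] is the true surplus of the unfolded tree. *)
Lemma gain_cnt k B A : (forall j A', j < k -> total j A' <= g A') ->
  \sum_X cntB k B A X * f X = msg k B A + \sum_Y cntA k B A Y * g Y.
Proof.
elim: k B A => [|k IH] B A le_tot; first by rewrite /= !big1.
have {}IH B' A' : \sum_X cntB k B' A' X * f X
    = msg k B' A' + \sum_Y cntA k B' A' Y * g Y.
  by apply: IH => j A'' lt_j; apply: le_tot; apply: ltnW.
rewrite [cntB _]lock [cntA _]lock; have [msg0|msg_gt0] := posnP (msg k.+1 B A).
  rewrite -!lock msg0 add0n !big1 // => x _; rewrite /cntA /cntB -/cntA -/cntB msg0 //.
have lhs : \sum_X cntB k.+1 B A X * f X = f B +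
    \sum_(A' | adj B A' && (A' != A)) \sum_(B' | adj B' A' && (B' != B))
       \sum_X cntB k B' A' X * f X.
  under eq_bigr => X _ do rewrite /cntB -/cntB (gtn_eqF msg_gt0) mulnDl.
  rewrite big_split /= sum_indicator; congr (_ + _).
  under eq_bigr => X _ do rewrite big_distrl /=.
  rewrite exchange_big; apply: eq_bigr => A' _ /=.
  under eq_bigr => X _ do rewrite big_distrl /=.
  by rewrite exchange_big.
have rhs : \sum_Y cntA k.+1 B A Y * g Y =
    \sum_(A' | adj B A' && (A' != A)) (g A' +
       \sum_(B' | adj B' A' && (B' != B)) \sum_Y cntA k B' A' Y * g Y).
  under eq_bigr => Y _ do rewrite /cntA -/cntA (gtn_eqF msg_gt0) big_distrl /=.
  rewrite exchange_big; apply: eq_bigr => A' _ /=.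
  under eq_bigr => Y _ do rewrite mulnDl big_distrl /=.
  by rewrite big_split /= sum_indicator exchange_big.
rewrite -!lock lhs rhs.
have -> : f B = msg k.+1 B A + \sum_(A' | adj B A' && (A' != A))
            (g A' - \sum_(B' | adj B' A' && (B' != B)) msg k B' A').
  by rewrite /= subnK // ltnW // -subn_gt0.
rewrite -addnA -big_split /=; congr (_ + _); apply: eq_bigr => A' _.
under [X in _ + X = _]eq_bigr => B' _ do rewrite IH.
rewrite big_split /= addnA subnK //.
exact: leq_trans (partial_total _ _ _) (le_tot k A' (ltnSn k)).
Qed.

(** Next to each inserted copy of X there is a removed copy of Y, as a child or as the parent; the
    parent of the root is A, whence the extra term. For a given X no copy of Y is used twice,
    because the walks never turn back: below a child of B only blocks other than B hang. *)
Lemma cover_cnt k B A X Y : adj X Y ->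
  cntB k B A X <= cntA k B A Y + ((X == B) && (Y == A)).
Proof.
move=> adjXY; elim: k B A => [//|k IH] B A.
rewrite /cntB /cntA -/cntB -/cntA; case: ifP => // _.
pose ind A' B' : nat := (X == B') && (Y == A').
apply: (@leq_trans ((X == B) + \sum_(A' | adj B A' && (A' != A))
  \sum_(B' | adj B' A' && (B' != B)) (cntA k B' A' Y + ind A' B'))).
  by rewrite leq_add2l; apply: leq_sum => A' _; apply: leq_sum => B' _; apply: IH.
under [X in _ + X]eq_bigr => A' _ do rewrite big_split /=.
rewrite !big_split /=; set S1 := \sum_(A' | _) \sum_(B' | _) cntA _ _ _ _.
suff le_ind : (X == B) + \sum_(A' | adj B A' && (A' != A))
      \sum_(B' | adj B' A' && (B' != B)) ind A' B'
    <= \sum_(A' | adj B A' && (A' != A)) (Y == A') + ((X == B) && (Y == A)).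
  by rewrite addnCA [leqRHS]addnAC [leqRHS]addnC leq_add2l.
have -> : \sum_(A' | adj B A' && (A' != A)) (Y == A') = (adj B Y && (Y != A)).
  have [BY|nBY] := boolP (adj B Y && (Y != A)).
    rewrite (bigD1 Y) //= eqxx big1 // => A' /andP[_ /negbTE].
    by rewrite eq_sym => ->.
  by rewrite big1 // => A' BA'; case: eqP => // E; rewrite E BA' in nBY.
have -> : \sum_(A' | adj B A' && (A' != A)) \sum_(B' | adj B' A' && (B' != B)) ind A' B'
    = [&& adj B Y, Y != A & X != B].
  have [/and3P[BY YA XB]|nBY] := boolP [&& adj B Y, Y != A & X != B].
    rewrite (bigD1 Y) ?BY //= (bigD1 X) ?adjXY //= /ind !eqxx.
    rewrite !big1 //= => [A' /andP[_ /negbTE nA']|B' /andP[_ /negbTE nB']].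
      by rewrite big1 // => B' _; rewrite [Y == A']eq_sym nA' andbF.
    by rewrite [X == B']eq_sym nB'.
  rewrite big1 // => A' /andP[BA' A'A]; rewrite big1 // => B' /andP[_ B'B].
  rewrite /ind; case: eqP => //= XB'; case: eqP => //= YA'.
  by rewrite XB' YA' BA' A'A B'B in nBY.
have [E|_] := eqVneq X B; last by case: (adj B Y); case: (Y != A).
by rewrite -E adjXY; case: (Y == A).
Qed.

Lemma degA5 A : #|[pred B | adj B A]| <= 5.
Proof. by apply: leq_trans (degA A) _; case/andP: (sa_bounds A). Qed.

Lemma degB5 B : #|[pred A | adj B A]| <= 5.
Proof. by apply: leq_trans (degB B) _; case/andP: (sb_bounds B). Qed.

Lemma size_cnt k B A : \sum_X cntB k B A X <= tree_bound k.
Proof.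
elim: k B A => [|k IH] B A; first by rewrite big1.
rewrite [tree_bound _]lock.
have [msg0|msg_neq0] := boolP (msg k.+1 B A == 0).
  by rewrite big1 // => X _; rewrite /cntB -/cntB msg0.
under eq_bigr => X _ do rewrite /cntB -/cntB (negbTE msg_neq0).
rewrite -lock big_split /= leq_add //.
  by have := @sum_indicator TB B (fun=> 1); under eq_bigr do rewrite muln1; move=> ->.
rewrite exchange_big /=.
have sumB A' : \sum_(i : TB) \sum_(B' | adj B' A' && (B' != B)) cntB k B' A' i
    <= 5 * tree_bound k.
  rewrite exchange_big /=.
  apply: (@leq_trans (\sum_(B' | adj B' A' && (B' != B)) tree_bound k)).
    by apply: leq_sum => B' _; apply: IH.
  rewrite sum_nat_const leq_mul2r; apply/orP; right; apply: leq_trans (degA5 A').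
  by apply: subset_leq_card; apply/subsetP => B'; rewrite !inE => /andP[].
apply: (@leq_trans (\sum_(A' | adj B A' && (A' != A)) 5 * tree_bound k)).
  by apply: leq_sum => A' _; apply: sumB.
rewrite sum_nat_const leq_mul2r; apply/orP; right; apply: leq_trans (degB5 B).
by apply: subset_leq_card; apply/subsetP => A'; rewrite !inE => /andP[].
Qed.

Lemma tree_bound_mono j k : j <= k -> tree_bound j <= tree_bound k.
Proof.
elim: j k => [//|j IH] [//|k] le_jk; rewrite /= leq_add2l !leq_mul2l /=.
exact: IH.
Qed.

(* The level sets of the multiplicities are genuine exchanges, so a tree with
   positive gain would contradict local optimality. *)
Lemma total_le k A : k <= K -> total k A <= g A.
Proof.
elim/ltn_ind: k A => k IH A le_kK.
have {}IH j A' : j < k -> total j A' <= g A'.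
  by move=> lt_jk; apply: IH => //; apply: ltnW; apply: leq_trans le_kK.
pose CB X := \sum_(B | adj B A) cntB k B A X.
pose CA Y := (Y == A) + \sum_(B | adj B A) cntA k B A Y.
have cov X Y : adj X Y -> CB X <= CA Y.
  move=> adjXY; apply: (@leq_trans (\sum_(B | adj B A)
      (cntA k B A Y + ((X == B) && (Y == A))))).
    by apply: leq_sum => B _; apply: cover_cnt.
  rewrite big_split /= addnC leq_add2r.
  have [E|_] := eqVneq Y A; last by rewrite big1 // => B; rewrite andbF.
  rewrite (bigD1 X) -?E //= eqxx big1 // => B /andP[_ /negbTE].
  by rewrite eq_sym => ->.
have sz : \sum_X CB X <= 5 * tree_bound K.
  rewrite /CB exchange_big /=; apply: (@leq_trans (\sum_(B | adj B A) tree_bound k)).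
    by apply: leq_sum => B _; apply: size_cnt.
  rewrite sum_nat_const leq_mul ?degA5 //; exact: tree_bound_mono.
have gainB : \sum_X CB X * f X = total k A
    + \sum_(B | adj B A) \sum_Y cntA k B A Y * g Y.
  under eq_bigr => X _ do rewrite big_distrl /=.
  rewrite exchange_big /= -big_split /=; apply: eq_bigr => B _.
  exact: gain_cnt.
have gainA : \sum_Y CA Y * g Y = g A
    + \sum_(B | adj B A) \sum_Y cntA k B A Y * g Y.
  under eq_bigr => Y _ do rewrite mulnDl big_distrl /=.
  by rewrite big_split /= sum_indicator exchange_big.
rewrite -(leq_add2r (\sum_(B | adj B A) \sum_Y cntA k B A Y * g Y)) -gainB -gainA.
pose M := \sum_X CB X + \sum_Y CA Y.
rewrite (@layer_cake _ CB f M); last first.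
  by move=> X; rewrite /M (bigD1 X) //= -addnA leq_addr.
rewrite (@layer_cake _ CA g M); last first.
  by move=> Y; rewrite /M [X in _ <= _ + X](bigD1 Y) //= addnCA leq_addr.
apply: leq_sum => t _.
pose S := [set X | t < CB X].
have cS : #|S| <= 5 * tree_bound K.
  apply: leq_trans sz; rewrite -sum1_card big_mkcond /=; apply: leq_sum => X _.
  by rewrite inE; case: ifP => // /(leq_trans _); apply.
have := local_opt cS; rewrite (eq_bigl (fun X => t < CB X)); last by move=> X; rewrite inE.
move=> /leq_trans; apply; rewrite big_mkcond [leqRHS]big_mkcond; apply: leq_sum => Y _.
case: existsP => // -[X /andP[]]; rewrite inE => lt_X adjXY.
by rewrite (leq_trans lt_X (cov X Y adjXY)).
Qed.

(** A deeper message enters through two nested subtractions, whose signs cancel. *)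
Lemma msg_mono k B A : msg k B A <= msg k.+1 B A.
Proof.
elim: k B A => [//|k IH] B A.
rewrite [msg k.+1]lock /= -lock; apply: leq_sub2l; apply: leq_sum => A' _.
by apply: leq_sub2l; apply: leq_sum => B' _; apply: IH.
Qed.

Definition slack k A := g A - total k A.

(* Discharging, up to the factor 60: besides its messages, a block of size a and
   slack d pays (d + a - 2) / a to each of the at most a blocks that it meets, hence
   (7 - a - d) + (d + a - 2) = 5 in total. *)
Definition share k A := (60 %/ sa A) * (slack k A + sa A - 2).

(** The factor 5 passes from the scale 12 of [charge] to the scale 60 of [share]; 60 is divisible by
    every size from 2 to 5, so the quotient in [share] is exact. *)
Lemma share_ge k A : 5 * charge (slack k A) <= share k A.
Proof.
have : slack k A <= 7 - sa A by apply: leq_subr.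
rewrite /share; case/andP: (sa_bounds A).
move: (sa A) (slack k A) => [|[|[|[|[|[|//]]]]]] // d _ _;
  by move: d => [|[|[|[|[|[|//]]]]]].
Qed.

(** Otherwise inserting B alone would remove nothing and gain at least 2. *)
Lemma neighbour_exists B : 0 < K -> exists A, adj B A.
Proof.
have [/existsP//|/existsPn noA] := boolP [exists A, adj B A].
move=> K_gt0; have := local_opt (S := [set B]); rewrite cards1 big_set1.
rewrite big1 => [|A /existsP[B' /andP[/set1P-> BA]]]; last by rewrite (negbTE (noA A)) in BA.
have [_ b5] := andP (sb_bounds B); case: K K_gt0 => // k _.
by rewrite leqn0 subn_eq0 => /(_ isT); lia.
Qed.

(** Let [A0] be the neighbour with the largest slack. Unfolding the message from B to [A0], each
    other neighbour A subtracts its slack plus the depth-k message from B to A. Hence [f B] is at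
    most the sum of all messages of B plus the slacks other than that of [A0]; [charge_num] turns
    these slacks into shares, with [A0] paying too. *)
Lemma block_charge k B : k < K ->
  60 * (6 - sb B) <= \sum_(A | adj B A) (60 * msg k.+1 B A + share k A).
Proof.
move=> lt_kK; have [A1 BA1] : exists A, adj B A.
  by apply: neighbour_exists; apply: leq_trans lt_kK.
have [A0 BA0 maxA0] := arg_maxnP (slack k) BA1.
pose others := [seq slack k A' | A' <- enum [pred A | adj B A && (A != A0)]].
have sum_others : sumn others = \sum_(A | adj B A && (A != A0)) slack k A.
  by rewrite sumnE big_map big_enum_cond /=; apply: eq_bigl => A; rewrite andbT.
have sum_charge : sumn (map charge others)
    = \sum_(A | adj B A && (A != A0)) charge (slack k A).
  by rewrite sumnE !big_map big_enum_cond /=; apply: eq_bigl => A; rewrite andbT.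
have bound : f B <= \sum_(A | adj B A) msg k.+1 B A + sumn others.
  have ub : f B <= \sum_(A' | adj B A' && (A' != A0))
      (g A' - \sum_(B' | adj B' A' && (B' != B)) msg k B' A') + msg k.+1 B A0.
    by rewrite -leq_subLR.
  have := msg_mono k B; move: (msg k.+1 B) ub => m1 ub mono.
  apply: leq_trans ub _; rewrite sum_others [in leqRHS](bigD1 A0) // addnC -addnA.
  rewrite leq_add2l -big_split /=; apply: leq_sum => A /andP[BA _].
  rewrite leq_subLR /slack; have := total_split k BA; have := total_le A (ltnW lt_kK).
  by have := mono A; lia.
have num := @charge_num (sb B) (slack k A0) others (sb_bounds B).
have {}num : 12 * (6 - sb B) <= 12 * (7 - sb B - sumn others)
    + sumn (map charge others) + charge (slack k A0).
  apply: num.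
  - apply: leq_trans (leq_subr _ _) _; rewrite /g.
    by have := sa_bounds A0; lia.
  - rewrite size_map -cardE; apply: leq_trans (degB B).
    rewrite [leqRHS](cardD1x (j := A0)) //= add1n ltnS; exact: leqnn.
  - apply/allP => d /mapP[A]; rewrite mem_enum => /andP[BA _] ->; exact: maxA0.
have le_share : 5 * (sumn (map charge others) + charge (slack k A0))
    <= \sum_(A | adj B A) share k A.
  rewrite [leqRHS](bigD1 A0) //= mulnDr addnC leq_add ?share_ge //.
  by rewrite sum_charge big_distrr /=; apply: leq_sum => A _; apply: share_ge.
have -> : \sum_(A | adj B A) (60 * msg k.+1 B A + share k A)
    = 60 * \sum_(A | adj B A) msg k.+1 B A + \sum_(A | adj B A) share k A.
  by rewrite big_split big_distrr.
move: bound num le_share; rewrite /f; move: (\sum_(A | _) msg _ _ _) => m.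
by clear; lia.
Qed.

Lemma node_share k A : k < K ->
  \sum_(B | adj B A) share k A + 60 * total k A <= 300.
Proof.
move=> lt_kK; rewrite sum_nat_const /share mulnA.
have le_deg : #|[pred B | adj B A]| * (60 %/ sa A) <= 60.
  by apply: leq_trans (leq_trunc_div 60 (sa A)); rewrite mulnC leq_mul.
apply: leq_trans (leq_add (leq_mul le_deg (leqnn _)) (leqnn _)) _.
have := total_le A (ltnW lt_kK); rewrite /slack /g; have := sa_bounds A; lia.
Qed.

Definition grand_total k := \sum_A total k A.

(** Double counting over adjacent pairs. The blocks B are paid with messages of depth [k.+1], while
    a block A can afford its shares only next to its total of depth [k]; hence the two grand
    totals. *)
Lemma step_bound k : k < K ->
  \sum_B (6 - sb B) + grand_total k <= grand_total k.+1 + 5 * #|TA|.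
Proof.
move=> lt_kK; rewrite -(leq_pmul2l (isT : 0 < 60)) !mulnDr.
have sB : 60 * \sum_B (6 - sb B) <= 60 * grand_total k.+1
    + \sum_A \sum_(B | adj B A) share k A.
  rewrite big_distrr /=.
  apply: (@leq_trans (\sum_B \sum_(A | adj B A) (60 * msg k.+1 B A + share k A))).
    by apply: leq_sum => B _; apply: block_charge.
  rewrite (exchange_big_dep xpredT) //= /grand_total big_distrr -big_split /=.
  by apply: leq_sum => A _; rewrite big_split /= -big_distrr.
have sA : \sum_A \sum_(B | adj B A) share k A + 60 * grand_total k <= 300 * #|TA|.
  rewrite /grand_total big_distrr -big_split /= mulnC -sum_nat_const.
  by apply: leq_sum => A _; apply: node_share.
by move: sA sB; clear; lia.
Qed.

(** The grand totals telescope over [k < K]; the one that survives, at depth [K], is at most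
    [5 * #|TA|] because a weight [g A] is at most 5. *)
Lemma local_optimum_bound :
  K * \sum_B (6 - sb B) <= 5 * K * #|TA| + 5 * #|TA|.
Proof.
have telescope k : k <= K -> k * \sum_B (6 - sb B) <= grand_total k + 5 * k * #|TA|.
  elim: k => [|k IH] le_k; first by rewrite mul0n.
  have -> : 5 * k.+1 * #|TA| = 5 * #|TA| + 5 * k * #|TA| by rewrite mulnS mulnDl.
  have := leq_add (step_bound le_k) (IH (ltnW le_k)).
  by rewrite [k.+1 * _]mulSn addnAC -addnA [grand_total k + _]addnC addnA => H; lia.
apply: leq_trans (telescope K (leqnn K)) _; rewrite addnC leq_add2l.
rewrite mulnC -sum_nat_const; apply: leq_sum => A _.
apply: leq_trans (total_le A (leqnn K)) _; rewrite /g.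
by have := sa_bounds A; lia.
Qed.

End LocalOptimum.

(** * The local search *)

Lemma gain_cat P Q : gain (P ++ Q) = gain P + gain Q.
Proof. by rewrite /gain map_cat sumn_cat. Qed.

Lemma gain_filter (a : pred (seq node)) P :
  gain P = gain [seq s <- P | a s] + gain [seq s <- P | ~~ a s].
Proof. by elim: P => //= s P; rewrite /gain /=; case: (a s) => /= ->; lia. Qed.

Definition stable C e P := {in moves C e, forall Q, gain (swap P Q) <= gain P}.

Lemma improve_stable P Q : gain (swap P Q) <= gain P -> improve P Q = P.
Proof. by rewrite /improve ltnNge => ->. Qed.

Lemma gain_foldl_improve P M :
  gain P < gain (foldl improve P M) \/
  foldl improve P M = P /\ {in M, forall Q, gain (swap P Q) <= gain P}.
Proof.
elim: M P => [|Q M IH] P /=; first by right.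
have [lt_g|le_g] := ltnP (gain P) (gain (swap P Q)).
  have -> : improve P Q = swap P Q by rewrite /improve lt_g.
  by left; case: (IH (swap P Q)) => [|[-> _]] //; apply: ltn_trans.
rewrite improve_stable //; case: (IH P) => [|[-> st]]; [by left | right; split=> // Q'].
by rewrite inE => /orP[/eqP->//|]; apply: st.
Qed.

(** Once a pass changes nothing, all later passes repeat it; until then each pass gains at least
    1. *)
Lemma search_progress C e P (ts : seq node) :
  let P' := foldl (fun P _ => pass C e P) P ts in
  gain P + size ts <= gain P' \/ stable C e P'.
Proof.
elim: ts P => [|t ts IH] P /=; first by left; rewrite addn0.
have [lt_g|[eP st]] := gain_foldl_improve P (moves C e); last first.
  have fixP : pass C e P = P by [].
  right; suff -> : foldl (fun P _ => pass C e P) (pass C e P) ts = P by [].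
  rewrite fixP; elim: (ts) => //= _ ts' IH'; by rewrite fixP.
case: (IH (pass C e P)) => [le_g|]; [left | by right].
by apply: leq_trans le_g; rewrite addnS -addSn leq_add2r.
Qed.

Definition small_packing e P := all (mem (small_blocks e)) P /\ uniq (flatten P).

Lemma mem_small_blocks e s : (s \in small_blocks e) =
  [&& block_ok e s, size s <= 5 & all (mem (nodes e)) s].
Proof. by rewrite mem_filter mem_words. Qed.

Lemma small_packing_swap C e P Q :
  small_packing e P -> Q \in moves C e -> small_packing e (swap P Q).
Proof.
move=> [smP uP]; rewrite mem_filter mem_words => /and3P[uQ _ smQ]; split.
  by rewrite all_cat smQ all_filter (sub_all _ smP) // => s /= ->; rewrite implybT.
rewrite flatten_cat cat_uniq uQ /=; apply/andP; split.
  apply/hasPn => v /flattenP[s]; rewrite mem_filter => /andP[/hasPn nhit _] vs.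
  exact: nhit.
move: uP; elim: (P) => //= s P' IH; rewrite cat_uniq => /and3P[us /hasPn disj uP'].
case: ifP => _ /=; last exact: IH.
rewrite cat_uniq us IH // andbT; apply/hasPn => v /flattenP[s'].
rewrite mem_filter => /andP[_ s'P'] vs'; apply: disj; apply/flattenP.
by exists s'.
Qed.

Lemma small_packing_search C e : small_packing e (local_search C e).
Proof.
rewrite /local_search; have : small_packing e [::] by [].
elim: (ticks e) [::] => //= _ ts IH P smP; apply: IH.
rewrite /pass; have : {subset moves C e <= moves C e} by [].
elim: {1 3}(moves C e) P smP => //= Q M IHM P smP sub; apply: IHM => [|Q' Q'M].
  rewrite /improve; case: ifP => // _; apply: small_packing_swap smP _.
  by apply: sub; rewrite mem_head.
by apply: sub; rewrite inE Q'M orbT.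
Qed.

Lemma size_flatten_ge b (P : seq (seq node)) : all (fun s => b <= size s) P ->
  b * size P <= size (flatten P).
Proof.
elim: P => [|s P IH] /=; first by rewrite muln0.
by case/andP=> le_s /IH le_P; rewrite size_cat mulnS leq_add.
Qed.

Lemma small_packing_packing e P : small_packing e P -> packing e P.
Proof.
move=> [smP uP]; split=> //.
  by apply: sub_all smP => s; rewrite inE mem_small_blocks => /and3P[].
move=> v /flattenP[s /(allP smP)]; rewrite inE mem_small_blocks.
by case/and3P=> _ _ /allP sub /sub.
Qed.

Lemma size_flatten_le e P : packing e P -> size (flatten P) <= size (nodes e).
Proof. by case=> _ uP sub; apply: uniq_leq_size. Qed.

(** Gaining at every tick would give a gain of 6 times the number of nodes plus 1, the excess coming
    from the additional first tick, and this is beyond the maximum. *)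
Lemma stable_search C e : stable C e (local_search C e).
Proof.
have [le_g|//] := search_progress C e [::] (ticks e).
have smP := small_packing_search C e; rewrite -/(local_search C e) in le_g.
have pP := small_packing_packing smP; have := size_flatten_le pP.
have /size_flatten_ge : all (fun s => 1 <= size s) (local_search C e).
  by apply: sub_all (packing_ok pP) => s /and3P[].
have : gain (local_search C e) <= 6 * size (local_search C e).
  have := packing_ok pP; elim: (local_search C e) => //= s P IH.
  by case/andP=> /andP[s_gt0 _] /IH; rewrite /gain /=; lia.
move: le_g; rewrite /ticks /= !size_cat; lia.
Qed.

(** Each node of [L] lies in at most one of the disjoint lists. Applied in both directions, this
    bounds the degrees in the intersection graph by the block sizes. *)
Lemma card_meeting (T : finType) (F : T -> seq node) (L : seq node) :
  (forall x y v, v \in F x -> v \in F y -> x = y) ->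
  #|[pred x | has (mem (F x)) L]| <= size L.
Proof.
move=> disj; rewrite -sum1_card big_mkcond /=.
apply: (@leq_trans (\sum_x \sum_(v <- L) (v \in F x))).
  apply: leq_sum => x _; case: ifP => // /hasP[v vL vF].
  by have {}vF : v \in F x by []; rewrite (big_rem v) //= vF.
rewrite exchange_big /= -sum1_size; apply: leq_sum => v _.
have [[x vx]|none] := pselect (exists x, v \in F x).
  rewrite (bigD1 x) //= big1 ?addn0 ?leq_b1 // => y ne_yx.
  by apply/eqP; rewrite eqb0; apply: contra ne_yx => vy; apply/eqP; apply: disj vy vx.
by rewrite big1 // => x _; apply/eqP; rewrite eqb0; apply/negP => vx; apply: none; exists x.
Qed.

Lemma uniq_flatten_nth (P : seq (seq node)) (i j : 'I_(size P)) v :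
  uniq (flatten P) -> v \in nth [::] P i -> v \in nth [::] P j -> i = j.
Proof.
move=> uP vi vj; apply: val_inj => /=.
case: i j vi vj => [i lt_i] [j lt_j] /=.
elim: P uP i j lt_i lt_j => //= s P IH; rewrite cat_uniq => /and3P[_ /hasPn disj uP].
have no k : k < size P -> v \in s -> v \in nth [::] P k -> false.
  move=> lt_k vs vk; have /disj/negP : v \in flatten P.
    by apply/flattenP; exists (nth [::] P k); rewrite ?mem_nth.
  by case.
case=> [|i] [|j] //= lt_i lt_j vi vj; first by have := no _ lt_j vi vj.
  by have := no _ lt_i vj vi.
by rewrite (IH uP i j).
Qed.

Lemma subseq_flatten_map (T : Type) (F : T -> seq node) a s :
  subseq (flatten [seq F x | x <- s & a x]) (flatten [seq F x | x <- s]).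
Proof.
elim: s => //= x s IH; case: (a x) => /=; first exact: cat_subseq.
by apply: subseq_trans IH (suffix_subseq _ _).
Qed.

(** A single node has a positive value facing an empty sum on the other side. *)
Lemma block_size_ge2 e s : block_ok e s -> all (mem (nodes e)) s ->
  all (leq 1) e.1 -> all (leq 1) e.2 -> 2 <= size s.
Proof.
case: s => [|[b i] [|w s]] //= /and3P[_ _]; rewrite /side_sum /=.
rewrite andbT mem_nodes /= => bal lt_i pos1 pos2.
suff : 0 < value e (b, i) by case: b bal {lt_i} => /=; lia.
by rewrite /value /=; case: b lt_i {bal} => lt_i; rewrite (all_nthP 0 _).
Qed.

Lemma packing_compare e K P Bs : small_packing e P -> small_packing e Bs ->
    stable (5 * tree_bound K) e P -> all (leq 1) e.1 -> all (leq 1) e.2 ->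
  K * \sum_(s <- Bs) (6 - size s) <= 5 * K * size P + 5 * size P.
Proof.
move=> [smP uP] [smB uB] stP pos1 pos2.
pose adj (B : 'I_(size Bs)) (A : 'I_(size P)) :=
  has (mem (nth [::] Bs B)) (nth [::] P A).
have bounds s : s \in small_blocks e -> 2 <= size s <= 5.
  rewrite mem_small_blocks => /and3P[ok -> sub]; rewrite andbT.
  exact: block_size_ge2 ok sub pos1 pos2.
have in_B (B : 'I_(size Bs)) : nth [::] Bs B \in small_blocks e.
  by apply: (allP smB); apply: mem_nth.
have in_P (A : 'I_(size P)) : nth [::] P A \in small_blocks e.
  by apply: (allP smP); apply: mem_nth.
have degA A : #|[pred B | adj B A]| <= size (nth [::] P A).
  apply: (@card_meeting _ (fun B : 'I_(size Bs) => nth [::] Bs B)) => B B' v.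
  exact: uniq_flatten_nth.
have degB B : #|[pred A | adj B A]| <= size (nth [::] Bs B).
  apply: leq_trans (@card_meeting _ (fun A : 'I_(size P) => nth [::] P A) _ _).
    by apply/eq_leq/eq_card => A; rewrite !inE /adj has_sym.
  by move=> A A' v; apply: uniq_flatten_nth.
have opt (S : {set 'I_(size Bs)}) : #|S| <= 5 * tree_bound K ->
    \sum_(B in S) (7 - size (nth [::] Bs B))
    <= \sum_(A | [exists B in S, adj B A]) (7 - size (nth [::] P A)).
  move=> cS; pose Q := map (fun B : 'I_(size Bs) => nth [::] Bs B) (enum S).
  have QM : Q \in moves (5 * tree_bound K) e.
    rewrite mem_filter mem_words size_map -cardE cS /=; apply/andP; split.
      (* Writing [Bs] along its positions makes [Q] a selection from it in the same order, so its
         flattening is a subsequence and inherits uniqueness. *)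
      have E : Bs = map (fun B : 'I_(size Bs) => nth [::] Bs B) (enum 'I_(size Bs)).
        by rewrite (map_comp (nth [::] Bs) val) val_enum_ord -/(mkseq _ _) mkseq_nth.
      apply: subseq_uniq uB; rewrite [X in subseq _ (flatten X)]E.
      rewrite /Q enumT -[enum S]/(filter _ _) -enumT.
      exact: subseq_flatten_map.
    by apply/allP => s /mapP[B _ ->]; apply: in_B.
  have gainQ : gain Q = \sum_(B in S) (7 - size (nth [::] Bs B)).
    by rewrite /gain sumnE !big_map big_enum.
  (* The blocks of [P] not hit occur on both sides of the stability inequality; cancelling them
     compares [Q] with the blocks that it removes. *)
  have := stP Q QM; rewrite gain_cat (gain_filter (hit Q) P) leq_add2r gainQ.
  move=> /leq_trans; apply; rewrite /gain sumnE big_map big_filter.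
  rewrite (big_nth [::]) big_mkord; apply/eq_leq; apply: eq_bigl => A.
  apply/hasP/existsP => [[v vA /flattenP[_ /mapP[B BS ->] vB]]|[B /andP[BS]]].
    exists B; rewrite -mem_enum BS /=; apply/hasP; by exists v.
  move=> /hasP[v vA vB]; exists v => //; apply/flattenP.
  by exists (nth [::] Bs B) => //; apply/mapP; exists B; rewrite ?mem_enum.
have := local_optimum_bound (fun A => bounds _ (in_P A)) (fun B => bounds _ (in_B B))
  degA degB opt.
by rewrite card_ord (big_nth [::]) big_mkord.
Qed.

(** * Lower bound on the optimum *)

(** A substitute for connected components: starting from distinct labels, each edge merges at most
    two classes and so loses at most one label. *)
Lemma labelling (V : finType) (E : seq (V * V)) :
  exists2 c : V -> V, {in E, forall uv, c uv.1 = c uv.2}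
    & #|V| <= #|[set c v | v : V]| + size E.
Proof.
elim: E => [|[u v] E [c cE le_c]].
  exists id => //; rewrite addn0 -cardsT subset_leq_card //.
  by apply/subsetP => v _; apply/imsetP; exists v.
pose c' x := if c x == c u then c v else c x.
exists c' => [[a b]|].
  rewrite inE => /orP[/eqP[-> ->]|/cE /= E']; last by rewrite /c' E'.
  by rewrite /c' /= eqxx; case: ifP.
apply: leq_trans le_c _; rewrite /= addnS -addSn leq_add2r.
(* Only the label [c u] can disappear. *)
apply: (@leq_trans #|c u |: [set c' x | x : V]|); last first.
  by rewrite cardsU1 -add1n leq_add2r leq_b1.
apply: subset_leq_card; apply/subsetP => _ /imsetP[x _ ->]; rewrite !inE.
have [//|ne] := eqVneq (c x) (c u).
by apply/orP; right; apply/imsetP; exists x => //; rewrite /c' (negbTE ne).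
Qed.

Definition inst (I : pfctu) : instance :=
  ([seq supply i | i <- enum 'I_(nsrc I)], [seq demand j | j <- enum 'I_(nsnk I)]).

Lemma enc_inst I : enc (inst I) = enc_pfctu I.
Proof. by rewrite /enc_pfctu /enc /= /enc_pair_inst /enc /enc_seq_inst /= -!map_comp. Qed.

Lemma size_inst1 I : size (inst I).1 = nsrc I.
Proof. by rewrite size_map size_enum_ord. Qed.

Lemma size_inst2 I : size (inst I).2 = nsnk I.
Proof. by rewrite size_map size_enum_ord. Qed.

Lemma nth_inst1 I (i : 'I_(nsrc I)) : nth 0 (inst I).1 i = supply i.
Proof. by rewrite (nth_map i) ?size_enum_ord // nth_ord_enum. Qed.

Lemma nth_inst2 I (j : 'I_(nsnk I)) : nth 0 (inst I).2 j = demand j.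
Proof. by rewrite (nth_map j) ?size_enum_ord // nth_ord_enum. Qed.

Lemma sumn_inst I : sumn (inst I).1 = sumn (inst I).2.
Proof.
by rewrite sumnE big_map big_enum [RHS]sumnE [RHS]big_map [RHS]big_enum /= balanced.
Qed.

Notation vertex I := ('I_(nsrc I) + 'I_(nsnk I))%type.

Definition node_at (I : pfctu) (v : vertex I) : node :=
  match v with inl i => (true, i : nat) | inr j => (false, j : nat) end.

Lemma node_at_inj I : injective (@node_at I).
Proof. by move=> [i|j] [i'|j'] //= [] /val_inj ->. Qed.

Definition block_of (I : pfctu) (c : vertex I -> vertex I) w :=
  [seq node_at v | v <- enum [pred v | c v == w]].

Lemma side_sum_block_of I (c : vertex I -> vertex I) w :
  side_sum (inst I) true (block_of c w) = \sum_(i | c (inl i) == w) supply i /\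
  side_sum (inst I) false (block_of c w) = \sum_(j | c (inr j) == w) demand j.
Proof.
have E b : side_sum (inst I) b (block_of c w) =
    \sum_(v in [pred v | c v == w] | (node_at v).1 == b) value (inst I) (node_at v).
  by rewrite /side_sum sumnE big_map big_filter big_map big_enum_cond.
rewrite !E !big_sumType /=; split.
  rewrite [X in _ + X]big_pred0 ?addn0 => [|j]; last by rewrite andbF.
  by apply: eq_big => i; [rewrite andbT | rewrite /value /= nth_inst1].
rewrite big_pred0 ?add0n => [|i]; last by rewrite andbF.
by apply: eq_big => j; [rewrite andbT | rewrite /value /= nth_inst2].
Qed.

Local Open Scope ring_scope.

(** No positive cell joins two classes, so supply and demand of a class both equal the flow inside
    it. *)
Lemma label_balanced (R : realType) I (x : 'M[R]_(nsrc I, nsnk I))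
    (c : vertex I -> vertex I) w : feasible x ->
  (forall i j, 0 < x i j -> c (inl i) = c (inr j)) ->
  (\sum_(i | c (inl i) == w) supply i = \sum_(j | c (inr j) == w) demand j)%N.
Proof.
move=> [x_ge0 rowx colx] cx; apply/eqP; rewrite -(eqr_nat R) !natr_sum; apply/eqP.
have x0 i j : c (inl i) != c (inr j) -> x i j = 0.
  move=> ne; apply/eqP; rewrite eq_le x_ge0 andbT leNgt; apply/negP => /cx E.
  by rewrite E eqxx in ne.
under eq_bigr => i _ do rewrite -rowx.
under [RHS]eq_bigr => j _ do rewrite -colx.
transitivity (\sum_(i | c (inl i) == w) \sum_(j | c (inr j) == w) x i j).
  apply: eq_bigr => i /eqP ci; rewrite [LHS](bigID (fun j => c (inr j) == w)) /=.
  rewrite [X in _ + X]big1 ?addr0 // => j nj; apply: x0.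
  by rewrite ci eq_sym.
rewrite exchange_big; apply: eq_bigr => j /eqP cj.
rewrite [RHS](bigID (fun i => c (inl i) == w)) /=.
by rewrite [X in _ = _ + X]big1 ?addr0 // => i ni; apply: x0; rewrite cj.
Qed.

Local Close Scope ring_scope.

Lemma size_block_of I (c : vertex I -> vertex I) w :
  size (block_of c w) = #|[pred v | c v == w]|.
Proof. by rewrite size_map -cardE. Qed.

Lemma sum_block_of I (c : vertex I -> vertex I) :
  \sum_(w in [set c v | v : vertex I]) size (block_of c w) = #|{: vertex I}|.
Proof.
rewrite -sum1_card [RHS](partition_big c (mem [set c v | v : vertex I])) /=; last first.
  by move=> v _; apply: imset_f.
by apply: eq_bigr => w _; rewrite size_block_of -sum1_card.
Qed.

Lemma mem_block_of I (c : vertex I -> vertex I) w v :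
  (node_at v \in block_of c w) = (c v == w).
Proof. by rewrite mem_map ?mem_enum //; apply: node_at_inj. Qed.

Lemma node_at_nodes I (v : vertex I) : node_at v \in nodes (inst I).
Proof.
by rewrite mem_nodes; case: v => [i|j] /=; rewrite ?size_inst1 ?size_inst2.
Qed.

Lemma inst_pos I : all (leq 1) (inst I).1 /\ all (leq 1) (inst I).2.
Proof.
split; apply/allP => n /mapP[i _ ->]; [exact: supply_gt0 | exact: demand_gt0].
Qed.

Lemma optimum_labelling (R : realType) I (x : 'M[R]_(nsrc I, nsnk I)) :
  feasible x -> exists c : vertex I -> vertex I,
  [/\ size (nodes (inst I)) <= #|[set c v | v : vertex I]| + cost x
    & forall w, w \in [set c v | v : vertex I] -> block_ok (inst I) (block_of c w)].
Proof.
move=> fx; pose E := [seq (inl ij.1, inr ij.2) : vertex I * vertex I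
  | ij <- enum [set ij : 'I_(nsrc I) * 'I_(nsnk I) | (0 < x ij.1 ij.2)%R]].
have [c cE le_c] := labelling E; exists c; split.
  by move: le_c; rewrite size_map -cardE card_sum !card_ord size_nodes size_inst1 size_inst2.
move=> w /imsetP[v _ def_w]; apply/and3P; split.
- by rewrite size_block_of; apply/card_gt0P; exists v; rewrite inE def_w.
- by rewrite map_inj_uniq ?enum_uniq //; apply: node_at_inj.
have [-> ->] := side_sum_block_of c w; apply/eqP; apply: label_balanced fx _ => i j x_gt0.
by apply: (cE (inl i, inr j)); apply/mapP; exists (i, j); rewrite // mem_enum inE.
Qed.

Lemma labels_small_packing I (c : vertex I -> vertex I) :
  (forall w, w \in [set c v | v : vertex I] -> block_ok (inst I) (block_of c w)) ->
  small_packing (inst I) [seq block_of c w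
    | w <- enum [pred w | (w \in [set c v | v : vertex I]) && (size (block_of c w) <= 5)]].
Proof.
move=> ok; split.
  apply/allP => s /mapP[w]; rewrite mem_enum inE => /andP[cw sz] ->.
  rewrite inE mem_small_blocks ok // sz /=; apply/allP => _ /mapP[v _ ->].
  exact: node_at_nodes.
elim: (enum _) (enum_uniq [pred w | (w \in [set c v | v : vertex I])
  && (size (block_of c w) <= 5)]) => //= w ws IH /andP[w_ws u_ws].
rewrite cat_uniq IH // andbT map_inj_uniq ?enum_uniq /=; last exact: node_at_inj.
apply/hasPn => n /flattenP[_ /mapP[w' w'ws ->] /mapP[v]].
rewrite mem_enum inE => /eqP cv ->; rewrite mem_block_of cv.
by apply: contraNN w_ws => /eqP <-.
Qed.

Lemma count_labels I (c : vertex I -> vertex I) :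
  6 * #|[set c v | v : vertex I]| <=
  \sum_(s <- [seq block_of c w
    | w <- enum [pred w | (w \in [set c v | v : vertex I]) && (size (block_of c w) <= 5)]])
     (6 - size s) + #|{: vertex I}|.
Proof.
rewrite big_map big_enum_cond /= -(sum_block_of c) mulnC -sum_nat_const.
apply: (@leq_trans (\sum_(w in [set c v | v : vertex I])
  ((6 - size (block_of c w)) + size (block_of c w)))).
  by apply: leq_sum => w _; lia.
rewrite big_split leq_add2r /= (bigID (fun w => size (block_of c w) <= 5)) /=.
(* For a class with more than five nodes the truncated worth is 0, so restricting to small classes
   loses nothing. *)
rewrite [X in _ + X]big1 ?addn0; last by move=> w /andP[_]; lia.
by rewrite leq_eqVlt; apply/orP; left; apply/eqP; apply: eq_bigl => w; rewrite andbT.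
Qed.

Lemma label_le_half I (c : vertex I -> vertex I) :
  (forall w, w \in [set c v | v : vertex I] -> block_ok (inst I) (block_of c w)) ->
  2 * #|[set c v | v : vertex I]| <= #|{: vertex I}|.
Proof.
move=> ok; rewrite -(sum_block_of c) mulnC -sum_nat_const; apply: leq_sum => w cw.
have [pos1 pos2] := inst_pos I.
apply: block_size_ge2 (ok w cw) _ pos1 pos2.
by apply/allP => _ /mapP[v _ ->]; apply: node_at_nodes.
Qed.

Lemma search_quality (R : realType) I K (x : 'M[R]_(nsrc I, nsnk I)) p :
  feasible x ->
  let P := local_search (5 * tree_bound K) (inst I) in
  p + size P <= size (nodes (inst I)) ->
  5 * K * p <= 6 * K * cost x + 5 * cost x.
Proof.
move=> fx P le_p; have [c [le_N ok]] := optimum_labelling fx.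
have [pos1 pos2] := inst_pos I.
have smP : small_packing (inst I) P by apply: small_packing_search.
have stP := stable_search (C := 5 * tree_bound K) (e := inst I).
have cmp := packing_compare smP (labels_small_packing ok) stP pos1 pos2.
have cnt := count_labels c; have half := label_le_half ok.
(* With [half] this absorbs the error term: [size P] is at most half the number of nodes, which is
   at most [cost x]. *)
have P2 : 2 * size P <= size (nodes (inst I)).
  apply: leq_trans (size_flatten_le (small_packing_packing smP)).
  apply: size_flatten_ge; apply: sub_all smP.1 => s.
  rewrite inE mem_small_blocks => /and3P[oks _ sub].
  exact: block_size_ge2 oks sub pos1 pos2.
have cV : #|{: vertex I}| = size (nodes (inst I)).
  by rewrite card_sum !card_ord size_nodes size_inst1 size_inst2.
rewrite cV in cnt half.
move: cmp cnt half P2 le_N le_p; move: (size P) (size (nodes _)) (cost x).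
move: #|_| (\sum_(s <- _) _) => k S q N v cmp cnt half P2 le_N le_p.
clear -cmp cnt half P2 le_N le_p; nia.
Qed.

(** * The approximation theorem *)

(** The shape of [enc_rat] on a natural number: a nonnegative numerator [k] over the denominator 1,
    each with its sign bit. *)
Definition coded_plan C e :=
  [seq [seq ((false, k), (false, 1)) | k <- r] | r <- plan C e].

Lemma pt_coded_plan C : ptime (coded_plan C).
Proof.
apply: (pt_map (f := fun _ r => [seq ((false, k), (false, 1)) | k <- r])).
  by apply: (pt_map (f := fun _ k => ((false, k), (false, 1)))); pt.
by apply: pt_plan; pt.
Qed.

Definition final_log C I := greedy (inst I) (local_search C (inst I)).

Definition plan_mx C I : 'M[rat]_(nsrc I, nsnk I) :=
  \matrix_(i, j) ((entry (final_log C I) i j)%:R)%R.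

Lemma enc_rat_nat n : enc_rat (n%:R)%R = enc ((false, n), (false, 1)).
Proof. by rewrite /enc_rat -[(n%:R)%R]/((n%:Z)%:~R)%R numq_int denq_int. Qed.

Lemma enc_coded_plan C I : enc (coded_plan C (inst I)) = enc_plan (plan_mx C I).
Proof.
rewrite /enc_plan /coded_plan /plan -/(final_log C I) size_inst1 size_inst2.
rewrite -!val_enum_ord -!map_comp /enc /enc_seq_inst -!map_comp; congr enc_list.
apply: eq_map => i /=; rewrite /enc /enc_seq_inst -!map_comp; congr enc_list.
by apply: eq_map => j /=; rewrite mxE enc_rat_nat.
Qed.

Lemma init_storeE t : init_store t = st [:: t].
Proof.
by apply: (@funext nat tree) => -[|y] //; rewrite /init_store /update /st /= nth_nil.
Qed.

Local Open Scope ring_scope.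

Lemma plan_mx_spec (R : realType) C I :
  let P := local_search C (inst I) in
  let y : 'M[R]_(nsrc I, nsnk I) := map_mx ratr (plan_mx C I) in
  feasible y /\ (cost y + size P <= size (nodes (inst I)))%N.
Proof.
move=> P y; have pP : packing (inst I) P.
  exact: small_packing_packing (small_packing_search _ _).
have [full l_lt le_pos] := greedyP pP (sumn_inst I).
have y_entry i j : y i j = (entry (final_log C I) i j)%:R by rewrite !mxE ratr_nat.
split; first split.
- by move=> i j; rewrite y_entry ler0n.
- move=> i; under eq_bigr => j _ do rewrite y_entry.
  have := @greedy_entry_row (inst I) (final_log C I) i (fun t tl => (l_lt t tl).2).
  by rewrite size_inst2 full /value /= nth_inst1 -natr_sum => ->.
- move=> j; under eq_bigr => i _ do rewrite y_entry.
  have := @greedy_entry_col (inst I) (final_log C I) j (fun t tl => (l_lt t tl).1).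
  by rewrite size_inst1 full /value /= nth_inst2 -natr_sum => ->.
apply: leq_trans le_pos; rewrite leq_add2r; apply: leq_trans (card_entry_gt0 _ _ _).
by apply/eq_leq/eq_card => ij; rewrite !inE y_entry ltr0n.
Qed.

(** Costs are natural numbers, so one feasible plan is enough for a minimum to be attained; no
    compactness is involved. *)
Lemma optimum_exists (R : realType) I (y : 'M[R]_(nsrc I, nsnk I)) :
  feasible y -> exists v, is_optimum R I v.
Proof.
move=> fy; pose Q := [pred v | `[< exists2 x : 'M[R]_(nsrc I, nsnk I),
  feasible x & cost x = v >]].
have exQ : exists v, Q v by exists (cost y); apply/asboolP; exists y.
exists (ex_minn exQ); case: ex_minnP => v /asboolP Qv min_v; split=> // x fx.
by apply: min_v; apply/asboolP; exists x.
Qed.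

Theorem theorem1p3 (R : realType) (eps : R) (eps_gt0 : 0 < eps) :
  exists c : cmd,
    poly_time enc_pfctu c /\ approximates (6%:R / 5%:R + eps) c.
Proof.
(* The guarantee at depth [K] is the ratio 6/5 + 1/K, so [K] has to exceed 1/eps. *)
pose K := Num.bound eps^-1.
have le_K : eps^-1 < K%:R by apply: archi_boundP; rewrite invr_ge0 ltW.
have K_gt0 : 0 < K%:R :> R by apply: lt_trans le_K; rewrite invr_gt0.
pose C := (5 * tree_bound K)%N.
have [c [p run_c]] := pt_coded_plan C; exists c.
have {}run_c I : exists2 k, computes c (enc_pfctu I) k (enc_plan (plan_mx C I))
    & (k <= p.[tree_size (enc_pfctu I)])%N.
  have [k ex le_k] := run_c (inst I); exists k; last first.
    by move: le_k; rewrite /esz enc_inst.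
  exists (st [:: enc (coded_plan C (inst I))]); last first.
    by rewrite /st /= enc_coded_plan.
  by rewrite -enc_inst init_storeE.
split.
  by exists p => I; have [k run_k le_k] := run_c I; exists k, (enc_plan (plan_mx C I)).
move=> I; have [k run_k _] := run_c I; exists k, (plan_mx C I); split=> // y.
have [fy le_y] := plan_mx_spec R C I; split=> //.
have [v opt_v] := optimum_exists fy; exists v => //.
have [[x fx <-] _] := opt_v.
have le_cost : 5%:R * K%:R * (cost y)%:R
    <= 6%:R * K%:R * (cost x)%:R + 5%:R * (cost x)%:R :> R.
  by rewrite -!natrM -natrD ler_nat; apply: search_quality fx le_y.
have eps_K : 1 <= K%:R * eps.
  by rewrite -ler_pdivrMr // mul1r ltW.
rewrite -(ler_pM2l (_ : 0 < 5%:R * K%:R :> R)) ?mulr_gt0 //.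
apply: le_trans le_cost _.
have v_ge0 : 0 <= (cost x)%:R :> R by apply: ler0n.
have : 5%:R * (cost x)%:R <= 5%:R * (K%:R * eps) * (cost x)%:R :> R.
  by rewrite -mulrA ler_pM2l // ler_peMl.
move=> le_eps.
have -> : 5%:R * K%:R * ((6%:R / 5%:R + eps) * (cost x)%:R)
    = 6%:R * K%:R * (cost x)%:R + 5%:R * (K%:R * eps) * (cost x)%:R :> R by field.
by rewrite lerD2l.
Qed.
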